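(* The map $c:\mathcal M\to\mathcal W_{ptW}$, $A\mapsto c_A$, is a Brouwer algebra embedding of the Medvedev Brouwer algebra $(\mathcal M,\le_M,\otimes,\oplus,\to,\mathbb{N}^\mathbb{N},\emptyset)$ into $(\mathcal W_{ptW},\le_{ptW},\widehat{\overline{\sqcap}},\sqcup,\Rrightarrow,1,\infty)$; i.e., it is injective, satisfies $A\le_M B\iff c_A\le_{ptW}c_B$, and maps $A\otimes B$, $A\oplus B$, $B\to A$, $\mathbb{N}^\mathbb{N}$, $\emptyset$ to (the degrees of) $c_A\,\widehat{\overline{\sqcap}}\,c_B$, $c_A\sqcup c_B$, $c_B\Rrightarrow c_A$, $1$, $\infty$ respectively.
   Context: Medvedev: for $A,B\subseteq\mathbb{N}^\mathbb{N}$, $A\le_M B$ iff there is a computable $F:\subseteq\mathbb{N}^\mathbb{N}\to\mathbb{N}^\mathbb{N}$ with $B\subseteq\mathrm{dom}(F)$ and $F(B)\subseteq A$; $\mathcal M$ is the set of degrees. $A\otimes B:=\{0p:p\in A\}\cup\{1p:p\in B\}$, $A\oplus B:=\{\langle p,q\rangle:p\in A,q\in B\}$, $B\to A:=\{\langle n,q\rangle:(\forall p\in B)\,\varphi_n\langle q,p\rangle\in A\}$, where $\langle p,q\rangle(2n)=p(n)$, $\langle p,q\rangle(2n+1)=q(n)$, $\varphi$ is a G\''odel numbering of partial computable functions $\subseteq\mathbb{N}^\mathbb{N}\to\mathbb{N}^\mathbb{N}$ (utm, smn), and $\langle n,q\rangle$ a standard encoding. Problems are partial multi-valued maps between represented spaces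 (sets with surjective partial $\delta_X:\subseteq\mathbb{N}^\mathbb{N}\to X$); $F$ realizes $f$ if $\delta_YF(p)\in f(\delta_X(p))$ for $p\in\mathrm{dom}(f\circ\delta_X)$; $f\le_W g$ iff there are computable $H,K$ with $p\mapsto H\langle p,GK(p)\rangle$ realizing $f$ for every realizer $G$ of $g$. A top $\infty$ is adjoined ($f\le_W\infty$, $\infty\le_W f$ only if $f=\infty$; $f\sqcup\infty=\infty$, $f\sqcap\infty=f$, $\overline\infty=\widehat\infty=\infty$). $c_A:\mathbb{N}^\mathbb{N}\rightrightarrows\mathbb{N}^\mathbb{N}$, $p\mapsto A$ for $A\neq\emptyset$, $c_\emptyset=\infty$. Completion: $p-1$ is the concatenation of $p(0)-1,p(1)-1,\dots$ ($0-1$ empty); $\delta^\wp_X(p)=\delta_X(p-1)$ if $p-1\in\mathrm{dom}(\delta_X)$; $\overline X=X\cup\{\bot\}$ with $\delta_{\overline X}(p)=\delta^\wp_X(p)$ if defined, $\bot$ otherwise; $\overline f(x)=f(x)$ on $\mathrm{dom}(f)$, $\overline Y$ otherwise. $\widehat f((x_n)_n)=\prod_if(x_i)$ on $\mathrm{dom}(f)^\mathbb{N}$. $f\sqcup g$: $(0,x)\mapsto\{0\}\times f(x)$, $(1,u)\mapsto\{1\}\times g(u)$; $(f\sqcap g)(x,u)=f(x)\sqcup g(u)$. Multiplicative implication (with $f^r=\delta_Y^{-1}f\delta_X$, multi-valued composition): $(g\twoheadrightarrow f)(p)=\{\langle n,k,q\rangle:\emptyset\ne\varphi_n\langle q,g^r\circ\varphi_k(p)\rangle\subseteq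 f^r(p)\}$ for $f,g\neq\infty$ with $\mathrm{dom}(g)\ne\emptyset$ or $\mathrm{dom}(f)=\emptyset$; $(g\twoheadrightarrow0)=0$, $(0\twoheadrightarrow f)=\infty$ for $f\not\equiv_W0$, $(\infty\twoheadrightarrow f)=0$, $(g\twoheadrightarrow\infty)=\infty$ for $g\ne\infty$. $f\le_{ptW}g:\iff f\le_W\widehat{\overline g}$; $\mathcal W_{ptW}$ its degrees including $\infty$; $1$ the degree of $\mathrm{id}$; $f\,\widehat{\overline\sqcap}\,g:=\widehat{\overline f}\sqcap\widehat{\overline g}$; $(g\Rrightarrow f):=(\widehat{\overline g}\twoheadrightarrow\widehat{\overline f})$. A Brouwer algebra embedding is an injective map, monotone in both directions, preserving infima, suprema, implication, bottom and top. *)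

(* Defs.v *)
From Stdlib Require Import Arith List Lia Classical ClassicalEpsilon
  FunctionalExtensionality.
From Stdlib Require Cantor.
Import ListNotations.

(** * Baire space *)

Definition baire : Type := nat -> nat.

Definition scons (n : nat) (p : baire) : baire :=
  fun i => match i with 0 => n | S j => p j end.

Definition stail (p : baire) : baire := fun i => p (S i).

Definition spair (p q : baire) : baire :=
  fun i => if Nat.even i then p (Nat.div2 i) else q (Nat.div2 i).

Definition sfst (r : baire) : baire := fun i => r (2 * i).
Definition ssnd (r : baire) : baire := fun i => r (2 * i + 1).

(** [sproj i] inverts the countable tupling
    [<p_0, p_1, ...> (<i, j>) = p_i j], with Cantor's pairing on [nat]. *)
Definition sproj (i : nat) (r : baire) : baire :=
  fun j => r (Cantor.to_nat (i, j)).

Lemma sfst_spair p q : sfst (spair p q) = p.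
Proof.
  extensionality i. unfold sfst, spair.
  rewrite Nat.even_mul. cbn [Nat.even orb]. now rewrite Nat.div2_double.
Qed.

Lemma ssnd_spair p q : ssnd (spair p q) = q.
Proof.
  extensionality i. unfold ssnd, spair.
  replace (2 * i + 1) with (S (2 * i)) by lia.
  rewrite Nat.even_succ, Nat.odd_mul. cbn [Nat.odd Nat.even negb andb].
  now rewrite Nat.div2_succ_double.
Qed.

(** * Partial functions and computability on Baire space *)

Record pfun : Type := Pfun {
  graph :> baire -> baire -> Prop;
  graph_functional : forall p q q', graph p q -> graph p q' -> q = q'
}.

Definition pdom (F : pfun) (p : baire) : Prop := exists q, F p q.

(** Programs for the partial recursive functions relative to an oracle, as
    unary functions on [nat], several arguments being packed with Cantor's
    pairing. *)
Inductive code : Type :=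
| czero | csucc | cleft | cright | coracle
| cpair (f g : code)
| ccomp (f g : code)
| cprec (f g : code)
| cmu (f : code).

(** Primitive recursion on partial functions given by their graphs:
    [h <a, 0> = f a] and [h <a, b + 1> = g <a, <b, h <a, b>>>]. *)
Fixpoint prec_graph (f g : nat -> nat -> Prop) (a b v : nat) : Prop :=
  match b with
  | 0 => f a v
  | S b' => exists w, prec_graph f g a b' w /\
      g (Cantor.to_nat (a, Cantor.to_nat (b', w))) v
  end.

(** [eval o c n m]: program [c] with oracle [o] halts on [n] with result [m]. *)
Fixpoint eval (o : baire) (c : code) (n m : nat) : Prop :=
  match c with
  | czero => m = 0
  | csucc => m = S n
  | cleft => m = fst (Cantor.of_nat n)
  | cright => m = snd (Cantor.of_nat n)
  | coracle => m = o n
  | cpair f g => exists a b,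
      eval o f n a /\ eval o g n b /\ m = Cantor.to_nat (a, b)
  | ccomp f g => exists a, eval o g n a /\ eval o f a m
  | cprec f g =>
      prec_graph (eval o f) (eval o g)
        (fst (Cantor.of_nat n)) (snd (Cantor.of_nat n)) m
  | cmu f => eval o f (Cantor.to_nat (n, m)) 0 /\
      forall j, j < m -> exists v, eval o f (Cantor.to_nat (n, j)) (S v)
  end.

Lemma eval_functional o c :
  forall n m m', eval o c n m -> eval o c n m' -> m = m'.
Proof.
  induction c as [| | | | |f IHf g IHg|f IHf g IHg|f IHf g IHg|f IHf];
    simpl; intros n m m' H H'; try congruence.
  - destruct H as (a & b & Ha & Hb & ->), H' as (a' & b' & Ha' & Hb' & ->).
    now rewrite (IHf _ _ _ Ha Ha'), (IHg _ _ _ Hb Hb').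
  - destruct H as (a & Ha & H), H' as (a' & Ha' & H').
    rewrite (IHg _ _ _ Ha Ha') in H. eauto.
  - revert m m' H H'. generalize (fst (Cantor.of_nat n)) as a.
    induction (snd (Cantor.of_nat n)) as [|b IHb]; simpl; intros a m m' H H'.
    + eauto.
    + destruct H as (w & Hw & H), H' as (w' & Hw' & H').
      rewrite (IHb _ _ _ Hw Hw') in H. eauto.
  - destruct H as [H1 H2], H' as [H1' H2'].
    destruct (lt_eq_lt_dec m m') as [[L|E]|L]; [|exact E|].
    + destruct (H2' _ L) as [v Hv]. discriminate (IHf _ _ _ H1 Hv).
    + destruct (H2 _ L) as [v Hv]. discriminate (IHf _ _ _ H1' Hv).
Qed.

(** The partial functional computed by a program, with its natural domain. *)
Definition computed (e : code) : pfun.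
Proof.
  refine (Pfun (fun p q => forall i, eval p e i (q i)) _).
  intros p q q' H H'. extensionality i. exact (eval_functional _ _ _ _ _ (H i) (H' i)).
Defined.

(** The program may also converge outside the domain of [F]. *)
Definition computable (F : pfun) : Prop :=
  exists e, forall p q, F p q -> computed e p q.

Definition computable_nat (s : nat -> nat) : Prop :=
  exists e, forall o n, eval o e n (s n).

Definition pfun_eq (F G : pfun) : Prop := forall p q, F p q <-> G p q.

Record goedel_numbering (phi : nat -> pfun) : Prop := {
  gn_sound : forall n, exists e, pfun_eq (phi n) (computed e);
  gn_complete : forall e, exists n, pfun_eq (phi n) (computed e);
  gn_utm : exists u, forall n p q,
    phi n p q <-> computed u (scons n p) q;
  gn_smn : forall e, exists s, computable_nat s /\
    forall n p q, phi (s n) p q <-> computed e (scons n p) q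
}.

(** * Medvedev reducibility *)

Definition med_le (A B : baire -> Prop) : Prop :=
  exists F : pfun, computable F /\
    (forall p, B p -> pdom F p) /\
    (forall p q, B p -> F p q -> A q).

Definition med_otimes (A B : baire -> Prop) : baire -> Prop :=
  fun r => (exists p, A p /\ r = scons 0 p) \/ (exists p, B p /\ r = scons 1 p).

Definition med_oplus (A B : baire -> Prop) : baire -> Prop :=
  fun r => exists p q, A p /\ B q /\ r = spair p q.

(** [med_imp phi B A] is [B -> A]; the pair [<n, q>] is [scons n q]. *)
Definition med_imp (phi : nat -> pfun) (B A : baire -> Prop) : baire -> Prop :=
  fun r => exists n q, r = scons n q /\
    forall p, B p -> exists s, phi n (spair q p) s /\ A s.

(** * Represented spaces *)

Record repspace : Type := Repspace {
  carrier :> Type;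
  rep : baire -> carrier -> Prop;
  rep_functional : forall p x y, rep p x -> rep p y -> x = y;
  rep_surjective : forall x, exists p, rep p x
}.
Arguments rep {r}.

Definition baire_space : repspace.
Proof.
  refine (Repspace baire (fun p x => p = x) _ _).
  - congruence.
  - intros x. now exists x.
Defined.

Definition prod_space (X Y : repspace) : repspace.
Proof.
  refine (Repspace (X * Y)
    (fun r z => rep (sfst r) (fst z) /\ rep (ssnd r) (snd z)) _ _).
  - intros r [x y] [x' y'] [H1 H2] [H1' H2']; simpl in *.
    f_equal; eapply rep_functional; eauto.
  - intros [x y]. destruct (rep_surjective X x) as [p Hp], (rep_surjective Y y) as [q Hq].
    exists (spair p q). rewrite sfst_spair, ssnd_spair. auto.
Defined.

Definition sum_space (X Y : repspace) : repspace.
Proof.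
  refine (Repspace (X + Y)
    (fun r z => match z with
                | inl x => r 0 = 0 /\ rep (stail r) x
                | inr y => r 0 = 1 /\ rep (stail r) y
                end) _ _).
  - intros r [x|y] [x'|y'] [H1 H2] [H1' H2']; try congruence;
      f_equal; eapply rep_functional; eauto.
  - intros [x|y].
    + destruct (rep_surjective X x) as [p Hp]. now exists (scons 0 p).
    + destruct (rep_surjective Y y) as [p Hp]. now exists (scons 1 p).
Defined.

Definition seq_space (X : repspace) : repspace.
Proof.
  refine (Repspace (nat -> X) (fun r x => forall i, rep (sproj i r) (x i)) _ _).
  - intros r x y H H'. extensionality i. eapply rep_functional; eauto.
  - intros x.
    pose (c := fun i => constructive_indefinite_description _ (rep_surjective X (x i))).
    exists (fun k => proj1_sig (c (fst (Cantor.of_nat k))) (snd (Cantor.of_nat k))).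
    intros i.
    replace (sproj i _) with (proj1_sig (c i)) by
      (extensionality j; unfold sproj; now rewrite Cantor.cancel_of_to).
    exact (proj2_sig (c i)).
Defined.

(** The finite word obtained by concatenating [p 0 - 1, ..., p (k - 1) - 1],
    where [0 - 1] is the empty word. *)
Definition dec_word (p : baire) (k : nat) : list nat :=
  flat_map (fun i => match p i with 0 => [] | S m => [m] end) (seq 0 k).

(** [dec p q]: the concatenation [p - 1] is infinite and equals [q]. *)
Definition dec (p q : baire) : Prop :=
  (forall k, dec_word p k = map q (seq 0 (length (dec_word p k)))) /\
  (forall m, exists k, m < length (dec_word p k)).

Lemma dec_functional p q q' : dec p q -> dec p q' -> q = q'.
Proof.
  intros [H1 H2] [H1' _]. extensionality m. destruct (H2 m) as [k Hk].
  pose proof (eq_trans (eq_sym (H1 k)) (H1' k)) as E.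
  apply (f_equal (fun l => nth_error l m)) in E.
  rewrite !nth_error_map, nth_error_seq in E.
  apply Nat.ltb_lt in Hk. rewrite Hk in E. simpl in E. congruence.
Qed.

Lemma dec_succ p : dec (fun i => S (p i)) p.
Proof.
  assert (E : forall k, dec_word (fun i => S (p i)) k = map p (seq 0 k)).
  { intros k. unfold dec_word.
    induction (seq 0 k) as [|a l IH]; simpl; congruence. }
  split.
  - intros k. now rewrite E, length_map, length_seq.
  - intros m. exists (S m). rewrite E, length_map, length_seq. lia.
Qed.

Definition precomp_rep (X : repspace) (p : baire) (x : X) : Prop :=
  exists q, dec p q /\ rep q x.

(** The completion of [X], with [None] in the role of the bottom element. *)
Definition completion (X : repspace) : repspace.
Proof.
  refine (Repspace (option X)
    (fun p z => match z with
                | Some x => precomp_rep X p x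
                | None => ~ exists x, precomp_rep X p x
                end) _ _).
  - intros p [x|] [y|] H H'; try (exfalso; eauto; fail); auto.
    destruct H as (q & D & Hq), H' as (q' & D' & Hq').
    rewrite (dec_functional _ _ _ D D') in Hq.
    f_equal. eapply rep_functional; eauto.
  - intros [x|].
    + destruct (rep_surjective X x) as [p Hp].
      exists (fun i => S (p i)), p. split; auto using dec_succ.
    + exists (fun _ => 0). intros (x & q & [_ D] & _).
      destruct (D 0) as [k Hk]. revert Hk. unfold dec_word.
      induction (seq 0 k) as [|a l IH]; simpl; [lia|exact IH].
Defined.

(** * Problems and Weihrauch reducibility *)

(** A partial multi-valued map is given by its graph; its domain consists of
    the points with a nonempty set of values. *)
Definition mdom {X Y : Type} (f : X -> Y -> Prop) (x : X) : Prop :=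
  exists y, f x y.

Definition mcomp {X Y Z : Type} (g : Y -> Z -> Prop) (f : X -> Y -> Prop) :
  X -> Z -> Prop :=
  fun x z => (forall y, f x y -> mdom g y) /\ exists y, f x y /\ g y z.

Record mvmap : Type := Mvmap {
  src : repspace;
  tgt : repspace;
  mv :> src -> tgt -> Prop
}.

Inductive problem : Type :=
| Prob (f : mvmap)
| Top.

Definition realizes (F : pfun) (f : mvmap) : Prop :=
  forall p x, rep p x -> mdom f x ->
    exists q y, F p q /\ rep q y /\ f x y.

(** [p |-> H <p, G (K p)>] *)
Definition wcompose (H K G : pfun) : pfun.
Proof.
  refine (Pfun (fun p s => exists k g, K p k /\ G k g /\ H (spair p g) s) _).
  intros p s s' (k & g & Hk & Hg & Hs) (k' & g' & Hk' & Hg' & Hs').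
  rewrite (graph_functional _ _ _ _ Hk Hk') in Hg.
  rewrite (graph_functional _ _ _ _ Hg Hg') in Hs.
  exact (graph_functional _ _ _ _ Hs Hs').
Defined.

Definition w_le (f g : problem) : Prop :=
  match f, g with
  | _, Top => True
  | Top, Prob _ => False
  | Prob f, Prob g =>
      exists H K : pfun, computable H /\ computable K /\
        forall G : pfun, realizes G g -> realizes (wcompose H K G) f
  end.

Definition p_id : problem := Prob (Mvmap baire_space baire_space (fun p q => p = q)).

Definition p_zero : problem :=
  Prob (Mvmap baire_space baire_space (fun _ _ => False)).

Definition p_const (A : baire -> Prop) : problem :=
  if excluded_middle_informative (exists q, A q)
  then Prob (Mvmap baire_space baire_space (fun _ q => A q))
  else Top.

Definition mv_completion (f : mvmap) : mvmap :=
  Mvmap (completion (src f)) (completion (tgt f))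
    (fun a b =>
       (exists x y, a = Some x /\ b = Some y /\ f x y) \/
       ~ (exists x, a = Some x /\ mdom f x)).

Definition mv_parallel (f : mvmap) : mvmap :=
  Mvmap (seq_space (src f)) (seq_space (tgt f))
    (fun x y => forall i, f (x i) (y i)).

Definition mv_sup (f g : mvmap) : mvmap :=
  Mvmap (sum_space (src f) (src g)) (sum_space (tgt f) (tgt g))
    (fun a b => match a, b with
                | inl x, inl y => f x y
                | inr u, inr v => g u v
                | _, _ => False
                end).

Definition mv_inf (f g : mvmap) : mvmap :=
  Mvmap (prod_space (src f) (src g)) (sum_space (tgt f) (tgt g))
    (fun a b => mdom f (fst a) /\ mdom g (snd a) /\
                match b with
                | inl y => f (fst a) y
                | inr v => g (snd a) v
                end).

Definition p_completion (f : problem) : problem :=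
  match f with Prob f => Prob (mv_completion f) | Top => Top end.

Definition p_parallel (f : problem) : problem :=
  match f with Prob f => Prob (mv_parallel f) | Top => Top end.

Definition p_sup (f g : problem) : problem :=
  match f, g with
  | Prob f, Prob g => Prob (mv_sup f g)
  | _, _ => Top
  end.

Definition p_inf (f g : problem) : problem :=
  match f, g with
  | Prob f, Prob g => Prob (mv_inf f g)
  | Prob f, Top => Prob f
  | Top, g => g
  end.

(** [f^r], the composition of [f] with the representation of its source and
    the inverse of the representation of its target. *)
Definition mv_r (f : mvmap) : baire -> baire -> Prop :=
  mcomp (fun (y : tgt f) q => rep q y) (mcomp f (@rep (src f))).

(** [mv_mimp phi g f] is [g ->> f]; the triple [<n, k, q>] is
    [scons n (scons k q)]. *)
Definition mv_mimp (phi : nat -> pfun) (g f : mvmap) : mvmap :=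
  Mvmap baire_space baire_space
    (fun p t => exists n k q, t = scons n (scons k q) /\
       let h := mcomp (fun r s => phi n (spair q r) s) (mcomp (mv_r g) (phi k)) in
       mdom h p /\ forall s, h p s -> mv_r f p s).

(** The multiplicative implication. In the case of two maps the
    value is [Top] exactly if [g] is nowhere defined and [f] is not. *)
Definition p_mimp (phi : nat -> pfun) (g f : problem) : problem :=
  match g, f with
  | Top, _ => p_zero
  | Prob _, Top => Top
  | Prob g, Prob f =>
      if excluded_middle_informative ((exists u, mdom g u) \/ ~ exists x, mdom f x)
      then Prob (mv_mimp phi g f)
      else Top
  end.

(** * Parallelized total Weihrauch reducibility *)

Definition p_pt (f : problem) : problem := p_parallel (p_completion f).

Definition ptw_le (f g : problem) : Prop := w_le f (p_pt g).

Definition ptw_inf (f g : problem) : problem := p_inf (p_pt f) (p_pt g).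

(** [ptw_imp phi g f] is the implication from [g] to [f]. *)
Definition ptw_imp (phi : nat -> pfun) (g f : problem) : problem :=
  p_mimp phi (p_pt g) (p_pt f).

(** * Degrees *)

Definition deg_class {T : Type} (le : T -> T -> Prop) (a : T) : T -> Prop :=
  fun b => le a b /\ le b a.

Definition degree {T : Type} (le : T -> T -> Prop) : Type :=
  {D : T -> Prop | exists a, D = deg_class le a}.

Definition deg {T : Type} (le : T -> T -> Prop) (a : T) : degree le :=
  exist _ (deg_class le a) (ex_intro _ a eq_refl).

Definition mdegree : Type := degree med_le.
Definition wdegree : Type := degree ptw_le.
Definition mdeg : (baire -> Prop) -> mdegree := deg med_le.
Definition wdeg : problem -> wdegree := deg ptw_le.

(* Main.v *)
From Stdlib Require Import Arith List Lia Classical ClassicalEpsilon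
  FunctionalExtensionality PropExtensionality ProofIrrelevance.
From Stdlib Require Cantor.
Require Import Defs.
Import ListNotations.

(* The map reflects the order because a realizer of the parallelized completion
   of [c_B] may answer every query with a fixed [b] in [B], so a reduction of
   [c_A] to it, applied to a fixed instance, is a Medvedev reduction. For each
   operation the two degrees are compared by such uniform translations of
   answers; the implication needs only a universal program.
   That the order on problems is transitive rests on one fact about programs:
   step-bounded evaluation turns every partial computable family of streams into
   a total one of completed names, which emits values in order and pads with [0]
   while waiting. *)

(** Transitivity of [ptw_le] requires that a reduction of [g] to the parallelized completion of [h]
    lift to the parallelized completion of [g]. That problem accepts every stream as an instance,
    whereas the given [H] and [K] need only converge on genuine names, and one divergent row must
    not block the others. Completion absorbs the failure: a row that stalls still names a point, and
    the completed problem is defined there. The rows have to be dovetailed, which calls for an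
    explicit interpreter with a step bound and not only for closure properties of computable
    operators. The other recurring case split comes from the empty set: [p_const] sends it to [Top],
    so for each operation the conventions about [Top] are matched against the Medvedev operation
    applied to an empty set. *)

Local Notation pr a b := (Cantor.to_nat (a, b)).
Local Notation p1 n := (fst (Cantor.of_nat n)).
Local Notation p2 n := (snd (Cantor.of_nat n)).

Local Opaque Cantor.to_nat Cantor.of_nat.

(** * Total computable operators *)

Definition bcomp (Phi : baire -> baire) : Prop :=
  exists e, forall p i, eval p e i (Phi p i).

Lemma bcomp_ext Phi Psi :
  (forall p i, Phi p i = Psi p i) -> bcomp Phi -> bcomp Psi.
Proof. intros E [e He]. exists e. intros p i. rewrite <- E. apply He. Qed.

Lemma p1_pr a b : p1 (pr a b) = a.
Proof. now rewrite Cantor.cancel_of_to. Qed.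

Lemma p2_pr a b : p2 (pr a b) = b.
Proof. now rewrite Cantor.cancel_of_to. Qed.

Lemma pr_p1_p2 n : pr (p1 n) (p2 n) = n.
Proof. now rewrite <- surjective_pairing, Cantor.cancel_to_of. Qed.

Lemma bcomp_index : bcomp (fun _ i => i).
Proof.
  exists (cpair cleft cright). intros p i. simpl.
  exists (p1 i), (p2 i). now rewrite pr_p1_p2.
Qed.

Lemma bcomp_S Phi : bcomp Phi -> bcomp (fun p i => S (Phi p i)).
Proof. intros [e He]. exists (ccomp csucc e). intros p i. simpl. eauto. Qed.

Lemma bcomp_cst c : bcomp (fun _ _ => c).
Proof.
  induction c as [|c IH].
  - now exists czero.
  - now apply (bcomp_S (fun _ _ => c)).
Qed.

Lemma bcomp_p1 Phi : bcomp Phi -> bcomp (fun p i => p1 (Phi p i)).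
Proof. intros [e He]. exists (ccomp cleft e). intros p i. simpl. eauto. Qed.

Lemma bcomp_p2 Phi : bcomp Phi -> bcomp (fun p i => p2 (Phi p i)).
Proof. intros [e He]. exists (ccomp cright e). intros p i. simpl. eauto. Qed.

Lemma bcomp_pr Phi Psi :
  bcomp Phi -> bcomp Psi -> bcomp (fun p i => pr (Phi p i) (Psi p i)).
Proof.
  intros [e He] [f Hf]. exists (cpair e f). intros p i. simpl.
  exists (Phi p i), (Psi p i). auto.
Qed.

Lemma bcomp_oracle Phi : bcomp Phi -> bcomp (fun p i => p (Phi p i)).
Proof. intros [e He]. exists (ccomp coracle e). intros p i. simpl. eauto. Qed.

Lemma bcomp_app Phi Psi :
  bcomp Psi -> bcomp Phi -> bcomp (fun p i => Psi p (Phi p i)).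
Proof. intros [f Hf] [e He]. exists (ccomp f e). intros p i. simpl. eauto. Qed.

(** The premise on [s] reads its arguments from [pr i (pr b w)], the format in which [cprec] calls
    its step program: parameter, counter, previous value. *)
Lemma bcomp_rec (z N : baire -> baire) (s : baire -> nat -> nat -> nat -> nat) :
  bcomp z -> bcomp (fun p m => s p (p1 m) (p1 (p2 m)) (p2 (p2 m))) -> bcomp N ->
  bcomp (fun p i => nat_rect (fun _ => nat) (z p i) (s p i) (N p i)).
Proof.
  intros [f Hf] [g Hg] HN. destruct bcomp_index as [c Hc].
  destruct HN as [n Hn].
  exists (ccomp (cprec f g) (cpair c n)). intros p i.
  exists (pr i (N p i)). split.
  - exists i, (N p i). auto.
  - simpl. rewrite p1_pr, p2_pr. induction (N p i) as [|b IH]; simpl.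
    + apply Hf.
    + eexists. split; [exact IH|].
      specialize (Hg p (pr i (pr b (nat_rect (fun _ => nat) (z p i) (s p i) b)))).
      simpl in Hg. now rewrite !p2_pr, !p1_pr in Hg.
Qed.

(** A case distinction is a primitive recursion whose step ignores the previous value. *)
Lemma bcomp_match (N z : baire -> baire) (s : baire -> nat -> nat -> nat) :
  bcomp N -> bcomp z -> bcomp (fun p m => s p (p1 m) (p2 m)) ->
  bcomp (fun p i => match N p i with 0 => z p i | S m => s p i m end).
Proof.
  intros HN Hz Hs.
  apply bcomp_ext with
    (fun p i => nat_rect (fun _ => nat) (z p i) (fun b _ => s p i b) (N p i)).
  - intros p i. now destruct (N p i).
  - apply bcomp_rec with (s := fun p i b _ => s p i b); auto.
    apply bcomp_ext with (fun p m => (fun p m => s p (p1 m) (p2 m)) p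
      ((fun _ m => pr (p1 m) (p1 (p2 m))) p m)).
    + intros p m. simpl. now rewrite p1_pr, p2_pr.
    + apply (bcomp_app (fun _ m => pr (p1 m) (p1 (p2 m)))
               (fun p m => s p (p1 m) (p2 m))); [exact Hs|].
      apply bcomp_pr; repeat (apply bcomp_p1 || apply bcomp_p2 || apply bcomp_index).
Qed.

Ltac bc :=
  cbv beta;
  first
    [ assumption
    | apply bcomp_index
    | apply bcomp_cst
    | apply bcomp_S; bc
    | apply bcomp_p1; bc
    | apply bcomp_p2; bc
    | apply bcomp_pr; bc
    | apply bcomp_oracle; bc
    | apply bcomp_match; bc
    | apply bcomp_rec; bc ].

Lemma bcomp_pred Phi : bcomp Phi -> bcomp (fun p i => pred (Phi p i)).
Proof.
  intros H.
  apply bcomp_ext with (fun p i => match Phi p i with 0 => 0 | S m => m end).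
  - intros p i. now destruct (Phi p i).
  - apply bcomp_match with (s := fun _ _ m => m); bc.
Qed.

Lemma bcomp_add Phi Psi :
  bcomp Phi -> bcomp Psi -> bcomp (fun p i => Phi p i + Psi p i).
Proof.
  intros H H'.
  apply bcomp_ext with (fun p i =>
    nat_rect (fun _ => nat) (Psi p i) (fun _ w => S w) (Phi p i)).
  - intros p i. induction (Phi p i); simpl; congruence.
  - apply bcomp_rec with (s := fun _ _ _ w => S w); bc.
Qed.

Lemma bcomp_sub Phi Psi :
  bcomp Phi -> bcomp Psi -> bcomp (fun p i => Phi p i - Psi p i).
Proof.
  intros H H'.
  apply bcomp_ext with (fun p i =>
    nat_rect (fun _ => nat) (Phi p i) (fun _ w => pred w) (Psi p i)).
  - intros p i. induction (Psi p i) as [|b IH]; simpl; lia.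
  - apply bcomp_rec with (s := fun _ _ _ w => pred w); [bc| |bc].
    apply bcomp_pred; bc.
Qed.

Lemma bcomp_even Phi Z O : bcomp Phi -> bcomp Z -> bcomp O ->
  bcomp (fun p i => if Nat.even (Phi p i) then Z p i else O p i).
Proof.
  intros H HZ HO.
  pose (par := fun n => nat_rect (fun _ => nat) 0
                 (fun _ w => match w with 0 => 1 | S _ => 0 end) n).
  assert (E : forall n, Nat.even n = match par n with 0 => true | S _ => false end).
  { induction n as [|n IH]; [reflexivity|].
    rewrite Nat.even_succ, <- Nat.negb_even, IH. simpl. fold (par n).
    now destruct (par n). }
  apply bcomp_ext with (fun p i => match par (Phi p i) with
                                   | 0 => Z p i | S _ => O p i end).
  - intros p i. rewrite E. now destruct (par (Phi p i)).
  - apply bcomp_match with (s := fun p i _ => O p i); [|bc|].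
    + apply bcomp_rec with
        (s := fun _ _ _ w => match w with 0 => 1 | S _ => 0 end); [bc| |bc].
      apply bcomp_match with (s := fun _ _ _ => 0); bc.
    + apply bcomp_app; bc.
Qed.

Lemma bcomp_div2 Phi : bcomp Phi -> bcomp (fun p i => Nat.div2 (Phi p i)).
Proof.
  intros H.
  apply bcomp_ext with (fun p i => nat_rect (fun _ => nat) 0
    (fun b w => if Nat.even b then w else S w) (Phi p i)).
  - intros p i. generalize (Phi p i) as n. induction n as [|n IH]; [reflexivity|].
    cbn [nat_rect]. rewrite IH. destruct (Nat.even n) eqn:E.
    + apply Nat.even_spec in E. destruct E as [k ->].
      now rewrite Nat.div2_succ_double, Nat.div2_double.
    + assert (O : Nat.odd n = true) by now rewrite <- Nat.negb_even, E.
      apply Nat.odd_spec in O. destruct O as [k ->].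
      replace (S (2 * k + 1)) with (2 * S k) by lia.
      replace (2 * k + 1) with (S (2 * k)) by lia.
      now rewrite Nat.div2_succ_double, Nat.div2_double.
  - apply bcomp_rec with (s := fun _ _ b w => if Nat.even b then w else S w);
      [bc| |bc].
    apply bcomp_even; bc.
Qed.

Lemma bcomp_spair Phi Psi :
  bcomp Phi -> bcomp Psi -> bcomp (fun p => spair (Phi p) (Psi p)).
Proof.
  intros H H'. unfold spair.
  apply bcomp_even; [bc| |]; (apply bcomp_app; [assumption|]); apply bcomp_div2; bc.
Qed.

Lemma bcomp_sfst Phi : bcomp Phi -> bcomp (fun p => sfst (Phi p)).
Proof.
  intros H. unfold sfst. apply bcomp_app; [assumption|].
  (* [2 * i] unfolds to [i + (i + 0)], whence the shape of the second summand. *)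
  apply (bcomp_add (fun _ i => i) (fun _ i => i + 0)); [bc|].
  apply bcomp_add; bc.
Qed.

Lemma bcomp_ssnd Phi : bcomp Phi -> bcomp (fun p => ssnd (Phi p)).
Proof.
  intros H. unfold ssnd. apply bcomp_app; [assumption|].
  apply bcomp_add; [|bc].
  apply (bcomp_add (fun _ i => i) (fun _ i => i + 0)); [bc|].
  apply bcomp_add; bc.
Qed.

Lemma bcomp_scons Phi Psi :
  bcomp Phi -> bcomp Psi -> bcomp (fun p => scons (Phi p 0) (Psi p)).
Proof.
  intros H H'. unfold scons.
  apply bcomp_match with (s := fun p _ j => Psi p j); [bc| |].
  - apply bcomp_app; bc.
  - apply bcomp_app; bc.
Qed.

Lemma bcomp_stail Phi : bcomp Phi -> bcomp (fun p => stail (Phi p)).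
Proof. intros H. unfold stail. apply bcomp_app; bc. Qed.

Lemma bcomp_sproj i Phi : bcomp Phi -> bcomp (fun p => sproj i (Phi p)).
Proof. intros H. unfold sproj. apply bcomp_app; bc. Qed.

Lemma bcomp_id : bcomp (fun p => p).
Proof. now exists coracle. Qed.

(** * Substituting a program for the oracle *)

(** Recursion and minimisation pair their own variable with the whole argument, giving
    [<<l, a>, b>]; this program restores [<l, <a, b>>], with the parameter outermost. *)
Definition cassoc : code :=
  cpair (ccomp cleft cleft) (cpair (ccomp cright cleft) cright).

(* The oracle is replaced by a program that also sees a parameter [l], which
   is carried along as the left component of every argument. *)
Fixpoint psubst (k e : code) : code :=
  match e with
  | czero => czero
  | csucc => ccomp csucc cright
  | cleft => ccomp cleft cright
  | cright => ccomp cright cright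
  | coracle => k
  | cpair f g => cpair (psubst k f) (psubst k g)
  | ccomp f g => ccomp (psubst k f) (cpair cleft (psubst k g))
  | cprec f g =>
      ccomp (cprec (psubst k f) (ccomp (psubst k g) cassoc))
        (cpair (cpair cleft (ccomp cleft cright)) (ccomp cright cright))
  | cmu f => cmu (ccomp (psubst k f) cassoc)
  end.

Lemma eval_assoc p l a b m :
  eval p cassoc (pr (pr l a) b) m <-> m = pr l (pr a b).
Proof.
  unfold cassoc. simpl. rewrite p1_pr, p2_pr. split.
  - intros (x & y & (u & -> & ->) & (v & w & (z & -> & ->) & -> & ->) & ->).
    now rewrite p1_pr, p2_pr.
  - intros ->. exists l, (pr a b). repeat split.
    + exists (pr l a). now rewrite p1_pr.
    + exists a, b. repeat split. exists (pr l a). now rewrite p2_pr.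
Qed.

Lemma eval_comp_assoc p f l a b m :
  eval p (ccomp f cassoc) (pr (pr l a) b) m <-> eval p f (pr l (pr a b)) m.
Proof.
  change (eval p (ccomp f cassoc) (pr (pr l a) b) m) with
    (exists x, eval p cassoc (pr (pr l a) b) x /\ eval p f x m).
  split.
  - intros (x & Hx & H). apply eval_assoc in Hx. now subst.
  - intros H. eexists. split; [now apply eval_assoc|assumption].
Qed.

(** An equivalence, so divergence is preserved as well: [delay_pcomp] applies it to a decoder whose
    input may decode to no stream at all. *)
Lemma eval_psubst p k l q (Hk : forall n, eval p k (pr l n) (q n)) e :
  forall n v, eval p (psubst k e) (pr l n) v <-> eval q e n v.
Proof.
  induction e as [| | | | |f IHf g IHg|f IHf g IHg|f IHf g IHg|f IHf];
    intros n v; cbn [psubst].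
  - reflexivity.
  - simpl. rewrite p2_pr. split; [intros (a & -> & H); exact H|eauto].
  - simpl. rewrite p2_pr. split; [intros (a & -> & H); exact H|eauto].
  - simpl. rewrite p2_pr. split; [intros (a & -> & H); exact H|eauto].
  - simpl. split; [|intros ->; apply Hk].
    intros H. exact (eval_functional _ _ _ _ _ H (Hk n)).
  - simpl. split; intros (a & b & Ha & Hb & ->); exists a, b.
    + rewrite <- IHf, <- IHg. auto.
    + rewrite IHf, IHg. auto.
  - simpl. rewrite p1_pr. split.
    + intros (a & (l' & b & -> & Hb & ->) & H). exists b.
      now rewrite <- IHg, <- IHf.
    + intros (b & Hb & H). exists (pr l b). rewrite IHf. split; [|assumption].
      exists l, b. now rewrite IHg.
  - assert (R : forall a b v,
      prec_graph (eval p (psubst k f)) (eval p (ccomp (psubst k g) cassoc))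
        (pr l a) b v <-> prec_graph (eval q f) (eval q g) a b v).
    { intros a b. induction b as [|b IHb]; intros w; cbn [prec_graph].
      - apply IHf.
      - split; intros (u & Hu & H); exists u; (split; [now apply IHb|]).
        + rewrite eval_comp_assoc in H. now apply IHg.
        + rewrite eval_comp_assoc. now apply IHg. }
    cbn [eval]. rewrite <- R. rewrite p1_pr, p2_pr. split.
    + intros (x & (y & z & (c & d & -> & (n' & -> & ->) & ->) &
                   (n'' & -> & ->) & ->) & H).
      rewrite p1_pr, p2_pr in H. exact H.
    + intros H. exists (pr (pr l (p1 n)) (p2 n)). rewrite p1_pr, p2_pr.
      split; [|exact H].
      exists (pr l (p1 n)), (p2 n). repeat split; eauto.
      exists l, (p1 n). repeat split; eauto.
  - change (eval q (cmu f) n v) with (eval q f (pr n v) 0 /\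
      forall j, j < v -> exists u, eval q f (pr n j) (S u)).
    change (eval p (cmu (ccomp (psubst k f) cassoc)) (pr l n) v) with
      (eval p (ccomp (psubst k f) cassoc) (pr (pr l n) v) 0 /\
       forall j, j < v ->
         exists u, eval p (ccomp (psubst k f) cassoc) (pr (pr l n) j) (S u)).
    rewrite eval_comp_assoc, IHf. split; intros [H1 H2]; (split; [assumption|]);
      intros j Hj; destruct (H2 j Hj) as [u Hu]; exists u.
    + now rewrite <- IHf, <- eval_comp_assoc.
    + now rewrite eval_comp_assoc, IHf.
Qed.

Lemma eval_comp_total p f g n a m :
  eval p g n a -> eval p (ccomp f g) n m <-> eval p f a m.
Proof.
  intros Ha. simpl. split; [|eauto]. intros (b & Hb & H).
  now rewrite (eval_functional _ _ _ _ _ Ha Hb).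
Qed.

Lemma oracle_subst k e : exists e', forall p q, computed k p q ->
  forall n v, eval p e' n v <-> eval q e n v.
Proof.
  (* No parameter is wanted here: the dummy [0] fills its place, and [cright] strips it before [k]
     runs. *)
  destruct (bcomp_pr (fun _ _ => 0) (fun _ i => i)) as [c Hc]; [bc|bc|].
  exists (ccomp (psubst (ccomp k cright) e) c). intros p q Hk n v.
  rewrite (eval_comp_total _ _ _ _ _ _ (Hc p n)). apply eval_psubst.
  intros m. exists m. split; [simpl; now rewrite p2_pr|apply Hk].
Qed.

(** * Step-bounded evaluation *)

(* The state of the search for the least [j] with [r j] finished with result [0]: [0]
   while the search goes on, [1] once it is blocked by an unfinished computation and
   [S (S m)] once [m] has been found. *)
Definition mu_state (r : nat -> nat) (t : nat) : nat :=
  nat_rect (fun _ => nat) 0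
    (fun j s => match s with
                | 0 => match r j with
                       | 0 => 1
                       | S r => match r with 0 => S (S j) | S _ => 0 end
                       end
                | S s' => S s'
                end) t.

(* The value [0] means that no result has been found yet, and [S m] that the
   result is [m]. *)
Fixpoint run (p : baire) (e : code) (t n : nat) : nat :=
  match e with
  | czero => 1
  | csucc => S (S n)
  | cleft => S (p1 n)
  | cright => S (p2 n)
  | coracle => S (p n)
  | cpair f g =>
      match run p f t n with
      | 0 => 0
      | S a => match run p g t n with 0 => 0 | S b => S (pr a b) end
      end
  | ccomp f g => match run p g t n with 0 => 0 | S a => run p f t a end
  | cprec f g =>
      nat_rect (fun _ => nat) (run p f t (p1 n))
        (fun b w => match w with
                    | 0 => 0
                    | S w' => run p g t (pr (p1 n) (pr b w'))
                    end) (p2 n)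
  | cmu f => pred (mu_state (fun j => run p f t (pr n j)) t)
  end.

Lemma mu_state_searching r t :
  mu_state r t = 0 <-> forall j, j < t -> exists v, r j = S (S v).
Proof.
  induction t as [|t IH]; [split; [lia|reflexivity]|].
  unfold mu_state in *. cbn [nat_rect]. split.
  - intros H j Hj. destruct (nat_rect _ _ _ t) as [|s] eqn:E; [|discriminate].
    assert (E' := proj1 IH eq_refl).
    destruct (Nat.eq_dec j t) as [->|]; [|apply E'; lia].
    destruct (r t) as [|[|v]]; try discriminate. eauto.
  - intros H. rewrite (proj2 IH); [|intros; apply H; lia].
    destruct (H t) as [v ->]; [lia|reflexivity].
Qed.

Lemma mu_state_found r t m :
  mu_state r t = S (S m) <->
  m < t /\ r m = 1 /\ forall j, j < m -> exists v, r j = S (S v).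
Proof.
  induction t as [|t IH]; [split; [discriminate|lia]|].
  pose proof (mu_state_searching r t) as Z.
  unfold mu_state in *. cbn [nat_rect]. destruct (nat_rect _ _ _ t) as [|s] eqn:E.
  - assert (H0 := proj1 Z eq_refl). destruct (r t) as [|[|v]] eqn:Et.
    + split; [discriminate|]. intros (H1 & H2 & _).
      destruct (Nat.eq_dec m t) as [->|]; [congruence|].
      destruct (H0 m) as [v Hv]; [lia|congruence].
    + split.
      * intros [= <-]. auto.
      * intros (H1 & H2 & H3). destruct (Nat.eq_dec m t) as [->|]; [congruence|].
        destruct (H0 m) as [v Hv]; [lia|congruence].
    + split; [discriminate|]. intros (H1 & H2 & _).
      destruct (Nat.eq_dec m t) as [->|]; [congruence|].
      destruct (H0 m) as [u Hu]; [lia|congruence].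
  - rewrite IH. split; intros (H1 & H2 & H3); repeat split; auto.
    destruct (Nat.eq_dec m t) as [->|]; [|lia].
    exfalso. apply Z in H3. discriminate.
Qed.

Lemma run_mu p f t n m :
  run p (cmu f) t n = S m <->
  m < t /\ run p f t (pr n m) = 1 /\
  forall j, j < m -> exists v, run p f t (pr n j) = S (S v).
Proof.
  rewrite <- (mu_state_found (fun j => run p f t (pr n j))).
  cbn [run]. lia.
Qed.

Lemma run_prec_S p f g t a b v :
  run p (cprec f g) t (pr a (S b)) = S v <->
  exists w, run p (cprec f g) t (pr a b) = S w /\
            run p g t (pr a (pr b w)) = S v.
Proof.
  cbn [run]. rewrite !p1_pr, !p2_pr. cbn [nat_rect].
  destruct (nat_rect _ _ _ b) as [|w].
  - split; [discriminate|]. intros (w & H & _). discriminate.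
  - split; [eauto|]. intros (w' & [= ->] & H). exact H.
Qed.

Lemma run_prec_0 p f g t a : run p (cprec f g) t (pr a 0) = run p f t a.
Proof. cbn [run]. now rewrite p1_pr, p2_pr. Qed.

(** Brings subcomputations that finish at different stages to a common one. A minimum once found
    stays, since finished tests keep their results. *)
Lemma run_mono p e : forall t t' n m,
  t <= t' -> run p e t n = S m -> run p e t' n = S m.
Proof.
  induction e as [| | | | |f IHf g IHg|f IHf g IHg|f IHf g IHg|f IHf];
    intros t t' n m Ht; try (simpl; auto; fail).
  - simpl. destruct (run p f t n) eqn:Ef; [discriminate|].
    destruct (run p g t n) eqn:Eg; [discriminate|].
    now rewrite (IHf _ _ _ _ Ht Ef), (IHg _ _ _ _ Ht Eg).
  - simpl. destruct (run p g t n) eqn:Eg; [discriminate|].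
    rewrite (IHg _ _ _ _ Ht Eg). eauto.
  - rewrite <- (pr_p1_p2 n). generalize (p1 n) as a. revert m.
    induction (p2 n) as [|b IHb]; intros m a.
    + rewrite !run_prec_0. eauto.
    + rewrite !run_prec_S. intros (w & Hw & H). eauto.
  - rewrite !run_mu. intros (H1 & H2 & H3). repeat split; [lia|eauto|].
    intros j Hj. destruct (H3 j Hj) as [v Hv]. eauto.
Qed.

Lemma run_sound p e : forall t n m, run p e t n = S m -> eval p e n m.
Proof.
  induction e as [| | | | |f IHf g IHg|f IHf g IHg|f IHf g IHg|f IHf];
    intros t n m; try (simpl; congruence).
  - simpl. destruct (run p f t n) eqn:Ef; [discriminate|].
    destruct (run p g t n) eqn:Eg; [discriminate|]. intros [= <-].
    do 2 eexists. eauto.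
  - simpl. destruct (run p g t n) eqn:Eg; [discriminate|]. eauto.
  - rewrite <- (pr_p1_p2 n). cbn [eval]. rewrite p1_pr, p2_pr.
    generalize (p1 n) as a. revert m. induction (p2 n) as [|b IHb]; intros m a.
    + rewrite run_prec_0. simpl. eauto.
    + rewrite run_prec_S. intros (w & Hw & H). simpl. eauto.
  - rewrite run_mu. intros (H1 & H2 & H3). split; [eauto|].
    intros j Hj. destruct (H3 j Hj) as [v Hv]. eauto.
Qed.

(** For minimisation: the finitely many tests before the minimum must all be finished at one
    stage. *)
Lemma uniform_bound (P : nat -> nat -> Prop) m :
  (forall j t t', t <= t' -> P j t -> P j t') ->
  (forall j, j < m -> exists t, P j t) -> exists t, forall j, j < m -> P j t.
Proof.
  intros M. induction m as [|m IH]; intros H.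
  - exists 0. lia.
  - destruct IH as [t Ht]; [auto|]. destruct (H m) as [u Hu]; [lia|].
    exists (max t u). intros j Hj. destruct (Nat.eq_dec j m) as [->|].
    + apply (M _ u); [lia|assumption].
    + apply (M _ t); [lia|]. apply Ht. lia.
Qed.

Lemma run_complete p e : forall n m, eval p e n m -> exists t, run p e t n = S m.
Proof.
  induction e as [| | | | |f IHf g IHg|f IHf g IHg|f IHf g IHg|f IHf];
    intros n m; try (simpl; intros ->; now exists 0).
  - intros (a & b & Ha & Hb & ->).
    destruct (IHf _ _ Ha) as [t Ht], (IHg _ _ Hb) as [u Hu].
    exists (max t u). simpl.
    now rewrite (run_mono p f t _ _ _ (Nat.le_max_l _ _) Ht),
      (run_mono p g u _ _ _ (Nat.le_max_r _ _) Hu).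
  - intros (a & Ha & H).
    destruct (IHg _ _ Ha) as [t Ht], (IHf _ _ H) as [u Hu].
    exists (max t u). simpl.
    rewrite (run_mono p g t _ _ _ (Nat.le_max_l _ _) Ht).
    exact (run_mono p f u _ _ _ (Nat.le_max_r _ _) Hu).
  - cbn [eval]. rewrite <- (pr_p1_p2 n), p1_pr, p2_pr.
    generalize (p1 n) as a. revert m. induction (p2 n) as [|b IHb]; intros m a.
    + simpl prec_graph. intros H. destruct (IHf _ _ H) as [t Ht]. exists t.
      now rewrite run_prec_0.
    + intros (w & Hw & H).
      destruct (IHb _ _ Hw) as [t Ht], (IHg _ _ H) as [u Hu].
      exists (max t u). apply run_prec_S. exists w. split.
      * exact (run_mono p (cprec f g) t _ _ _ (Nat.le_max_l _ _) Ht).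
      * exact (run_mono p g u _ _ _ (Nat.le_max_r _ _) Hu).
  - intros [H1 H2]. destruct (IHf _ _ H1) as [t Ht].
    destruct (uniform_bound (fun j t => exists v, run p f t (pr n j) = S (S v)) m)
      as [u Hu].
    + intros j t1 t2 L [v Hv]. exists v. exact (run_mono _ _ _ _ _ _ L Hv).
    + intros j Hj. destruct (H2 j Hj) as [v Hv]. destruct (IHf _ _ Hv). eauto.
    (* The search at stage [t] only inspects candidates below [t], so the stage must exceed [m]; [t]
       settles the zero test and [u] the earlier ones. *)
    + exists (S m + t + u). apply run_mu. repeat split; [lia| |].
      * apply (run_mono p f t); [lia|assumption].
      * intros j Hj. destruct (Hu j Hj) as [v Hv]. exists v.
        apply (run_mono p f u); [lia|assumption].
Qed.

Lemma bcomp_run_app e (T N : baire -> baire) :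
  bcomp (fun p m => run p e (p2 m) (p1 m)) -> bcomp T -> bcomp N ->
  bcomp (fun p i => run p e (T p i) (N p i)).
Proof.
  intros H HT HN.
  apply bcomp_ext with (fun p i => (fun p m => run p e (p2 m) (p1 m)) p
                                     ((fun p i => pr (N p i) (T p i)) p i)).
  - intros p i. cbv beta. now rewrite p1_pr, p2_pr.
  - apply (bcomp_app (fun p i => pr (N p i) (T p i))
             (fun p m => run p e (p2 m) (p1 m))); [assumption|].
    now apply bcomp_pr.
Qed.

(** The program [e] is fixed and only stage and argument are data, so an induction on [e] suffices
    and programs need not be coded as numbers. *)
Lemma bcomp_run e : bcomp (fun p m => run p e (p2 m) (p1 m)).
Proof.
  induction e as [| | | | |f IHf g IHg|f IHf g IHg|f IHf g IHg|f IHf];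
    cbn [run]; unfold mu_state; try bc.
  - apply bcomp_match with (s := fun p m a =>
      match run p g (p2 m) (p1 m) with 0 => 0 | S b => S (pr a b) end); [bc|bc|].
    apply bcomp_match with (s := fun p m b => S (pr (p2 m) b)); [|bc|bc].
    apply bcomp_run_app; bc.
  - apply bcomp_match with (s := fun p m a => run p f (p2 m) a); [bc|bc|].
    apply bcomp_run_app; bc.
  - apply bcomp_rec with (s := fun p m b w =>
      match w with 0 => 0 | S w' => run p g (p2 m) (pr (p1 (p1 m)) (pr b w')) end).
    + apply bcomp_run_app; bc.
    + apply bcomp_match with (s := fun p m w' => run p g (p2 (p1 m))
        (pr (p1 (p1 (p1 m))) (pr (p1 (p2 m)) w'))); [bc|bc|].
      apply bcomp_run_app; bc.
    + bc.
  - apply bcomp_pred.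
    apply bcomp_rec with (s := fun p m j s => match s with
        | 0 => match run p f (p2 m) (pr (p1 m) j) with
               | 0 => 1
               | S r => match r with 0 => S (S j) | S _ => 0 end
               end
        | S s' => S s'
        end); [bc| |bc].
    apply bcomp_match with (s := fun _ _ s' => S s'); [bc| |bc].
    apply bcomp_match with (s := fun _ m r =>
      match r with 0 => S (S (p1 (p2 m))) | S _ => 0 end); [|bc|].
    + apply bcomp_run_app; bc.
    + apply bcomp_match with (s := fun _ _ _ => 0); bc.
Qed.

(** * Decoding of completed names *)

Lemma dec_word_S p k :
  dec_word p (S k) =
  dec_word p k ++ match p k with 0 => [] | S m => [m] end.
Proof.
  unfold dec_word. rewrite seq_S, flat_map_app. simpl. now rewrite app_nil_r.
Qed.

Lemma dec_word_mono p m v : forall k k', k <= k' ->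
  nth_error (dec_word p k) m = Some v -> nth_error (dec_word p k') m = Some v.
Proof.
  intros k k' L H. induction L as [|k' L IH]; [assumption|].
  rewrite dec_word_S, nth_error_app1; [assumption|].
  apply nth_error_Some. congruence.
Qed.

(** Letters once emitted never change, so both clauses of [dec] reduce to one condition on each
    position, the form in which computations are compared. *)
Lemma dec_iff p q :
  dec p q <-> forall m, exists k, nth_error (dec_word p k) m = Some (q m).
Proof.
  split.
  - intros [H1 H2] m. destruct (H2 m) as [k Hk]. exists k.
    rewrite H1, nth_error_map, nth_error_seq.
    apply Nat.ltb_lt in Hk. now rewrite Hk.
  - intros H. split.
    + intros k. apply nth_error_ext. intros m.
      rewrite nth_error_map, nth_error_seq.
      destruct (m <? length (dec_word p k)) eqn:E.
      * destruct (H m) as [k' Hk'].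
        destruct (nth_error (dec_word p k) m) as [v|] eqn:Ev.
        -- apply (dec_word_mono p m _ k' (max k k')) in Hk'; [|lia].
           apply (dec_word_mono p m _ k (max k k')) in Ev; [|lia].
           simpl. congruence.
        -- apply nth_error_None in Ev. apply Nat.ltb_lt in E. lia.
      * apply Nat.ltb_ge in E. now apply nth_error_None.
    + intros m. destruct (H m) as [k Hk]. exists k.
      apply nth_error_Some. congruence.
Qed.

Lemma bcomp_dec_length : bcomp (fun p k => length (dec_word p k)).
Proof.
  apply bcomp_ext with (fun p k => nat_rect (fun _ => nat) 0
    (fun j w => match p j with 0 => w | S _ => S w end) k).
  - intros p k. induction k as [|k IH]; [reflexivity|].
    rewrite dec_word_S, length_app. cbn [nat_rect]. rewrite IH.
    destruct (p k); simpl; lia.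
  - apply bcomp_rec with
      (s := fun p _ j w => match p j with 0 => w | S _ => S w end); [bc| |bc].
    apply bcomp_match with (s := fun _ m _ => S (p2 (p2 m))); bc.
Qed.

Lemma dec_computable :
  exists e, forall p q, dec p q <-> computed e p q.
Proof.
  (* At [<m, k>] this difference vanishes exactly when the first [S k] entries of [p] contain more
     than [m] letters. The least such [k] is where letter [m] is emitted, and its value is
     [pred (p k)]. *)
  assert (H : bcomp (fun p m => S (p1 m) - length (dec_word p (S (p2 m))))).
  { apply bcomp_sub; [bc|].
    apply (bcomp_app (fun _ m => S (p2 m)) (fun p k => length (dec_word p k)));
      [apply bcomp_dec_length|bc]. }
  destruct H as [f Hf].
  destruct (bcomp_pred (fun p k => p k)) as [g Hg]; [bc|].
  exists (ccomp g (cmu f)). intros p q. rewrite dec_iff.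
  assert (E : forall m v, (exists k, nth_error (dec_word p k) m = Some v) <->
                          eval p (ccomp g (cmu f)) m v).
  { intros m v. change (eval p (ccomp g (cmu f)) m v) with
      (exists a, (eval p f (pr m a) 0 /\
        forall j, j < a -> exists u, eval p f (pr m j) (S u)) /\ eval p g a v).
    assert (F : forall k u, eval p f (pr m k) u <->
                            u = S m - length (dec_word p (S k))).
    { intros k u. specialize (Hf p (pr m k)). rewrite p1_pr, p2_pr in Hf.
      split; [|now intros ->]. intros Hu. exact (eval_functional _ _ _ _ _ Hu Hf). }
    assert (I : forall k, length (dec_word p k) <= m -> m < length (dec_word p (S k)) ->
              nth_error (dec_word p (S k)) m = Some (pred (p k))).
    { intros k. rewrite dec_word_S, length_app. destruct (p k) as [|w]; simpl; [lia|].
      intros H1 H2. assert (m = length (dec_word p k)) as -> by lia.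
      now rewrite nth_error_app2, Nat.sub_diag. }
    split.
    - intros [k Hk]. induction k as [|k IH]; [destruct m; discriminate|].
      destruct (le_lt_dec (length (dec_word p k)) m) as [L|L].
      + assert (L' : m < length (dec_word p (S k))).
        { apply nth_error_Some. congruence. }
        rewrite (I k L L') in Hk. injection Hk as <-.
        exists k. split; [split|apply Hg].
        * rewrite F. lia.
        * intros j Hj. exists (m - length (dec_word p (S j))). apply F.
          assert (length (dec_word p (S j)) <= length (dec_word p k)); [|lia].
          clear - Hj. induction Hj as [|k Hj IH]; [lia|].
          rewrite (dec_word_S p k), length_app. lia.
      + apply IH. destruct (nth_error (dec_word p k) m) as [w|] eqn:E.
        * apply (dec_word_mono p m w k (S k)) in E; [congruence|lia].
        * apply nth_error_None in E. lia.
    - intros (k & [H1 H2] & H3). exists (S k).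
      rewrite (eval_functional _ _ _ _ _ H3 (Hg p k)). apply F in H1.
      apply I; [|lia]. destruct k as [|k]; [simpl; lia|].
      destruct (H2 k) as [u Hu]; [lia|]. apply F in Hu. lia. }
  split; intros H m; apply E, H.
Qed.

(** [run] and completed names share a convention: [0] for nothing yet, [S v] for the value [v]. So
    row [i] can output at stage [t] the result of [run] on the first position not yet emitted, which
    [cnt] tracks. A divergent position stalls its row forever, hence the equivalence. *)
Lemma delay_computable e :
  exists D : baire -> baire, bcomp D /\
    forall p i q, dec (sproj i (D p)) q <-> forall m, eval p e (pr i m) (q m).
Proof.
  pose (cnt := fun p i t => nat_rect (fun _ => nat) 0
    (fun u c => match run p e u (pr i c) with 0 => c | S _ => S c end) t).
  exists (fun p n => run p e (p2 n) (pr (p1 n) (cnt p (p1 n) (p2 n)))). split.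
  { apply bcomp_run_app; [apply bcomp_run|bc|]. apply bcomp_pr; [bc|].
    apply bcomp_rec with (s := fun p n u c =>
      match run p e u (pr (p1 n) c) with 0 => c | S _ => S c end); [bc| |bc].
    apply bcomp_match with (s := fun _ m _ => S (p2 (p2 m))); [|bc|bc].
    apply bcomp_run_app; [apply bcomp_run|bc|bc]. }
  intros p i q. set (d := sproj i _).
  assert (Ed : forall t, d t = run p e t (pr i (cnt p i t))).
  { intros t. unfold d, sproj. now rewrite p1_pr, p2_pr. }
  assert (L : forall t, length (dec_word d t) = cnt p i t).
  { induction t as [|t IH]; [reflexivity|].
    rewrite dec_word_S, length_app, Ed, IH. unfold cnt. cbn [nat_rect].
    fold (cnt p i t). destruct (run p e t _); simpl; lia. }
  assert (V : forall t m v, nth_error (dec_word d t) m = Some v ->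
                            eval p e (pr i m) v).
  { induction t as [|t IH]; intros m v; [destruct m; discriminate|].
    rewrite dec_word_S. destruct (le_lt_dec (length (dec_word d t)) m) as [G|G].
    - rewrite nth_error_app2 by assumption. destruct (d t) as [|w] eqn:E.
      + destruct (m - _); discriminate.
      + destruct (m - length (dec_word d t)) as [|x] eqn:Ex;
          [|destruct x; discriminate].
        intros [= <-]. rewrite Ed in E. rewrite L in *.
        replace m with (cnt p i t) by lia. exact (run_sound _ _ _ _ _ E).
    - rewrite nth_error_app1 by assumption. apply IH. }
  rewrite dec_iff. split.
  - intros H m. destruct (H m) as [k Hk]. eauto.
  - intros H m.
    (* If exactly [m] letters are out at stage [u], the computation at position [m] has already
       finished, and the next entry emits its value. *)
    assert (U : forall m, exists k, m <= length (dec_word d k)).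
    { clear m. induction m as [|m [k Hk]]; [exists 0; lia|].
      destruct (run_complete p e _ _ (H m)) as [t Ht]. set (u := max k t).
      assert (Lu : length (dec_word d k) <= length (dec_word d u)).
      { assert (Hu : k <= u) by lia. clear - Hu.
        induction Hu as [|u Hu IH]; [lia|]. rewrite dec_word_S, length_app. lia. }
      destruct (Nat.eq_dec (length (dec_word d u)) m) as [E|]; [|exists u; lia].
      exists (S u). rewrite dec_word_S, length_app, Ed, <- L, E.
      rewrite (run_mono p e t u _ _ (Nat.le_max_r _ _) Ht). simpl. lia. }
    destruct (U (S m)) as [k Hk]. exists k.
    destruct (nth_error (dec_word d k) m) as [v|] eqn:E.
    + f_equal. exact (eval_functional _ _ _ _ _ (V _ _ _ E) (H m)).
    + apply nth_error_None in E. lia.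
Qed.

(** * Partial computable relations *)

(** The inclusion in a computed functional forces [R] to be functional, so composites can be written
    with existential quantifiers and no separate proof of functionality. *)
Definition pcomp (R : baire -> baire -> Prop) : Prop :=
  exists e, forall p q, R p q -> computed e p q.

Lemma pcomp_total Phi : bcomp Phi -> pcomp (fun p q => q = Phi p).
Proof. intros [e He]. exists e. intros p q ->. exact (He p). Qed.

Lemma pcomp_computed e : pcomp (computed e).
Proof. now exists e. Qed.

Lemma pcomp_dec : pcomp dec.
Proof. destruct dec_computable as [e He]. exists e. intros p q. apply He. Qed.

Lemma pcomp_comp (R T : baire -> baire -> Prop) :
  pcomp R -> pcomp T -> pcomp (fun p r => exists q, R p q /\ T q r).
Proof.
  intros [e He] [f Hf]. destruct (oracle_subst e f) as [g Hg]. exists g.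
  intros p r (q & HR & HT) i. apply (Hg p q (He _ _ HR)). exact (Hf _ _ HT i).
Qed.

Lemma pcomp_pre Phi R : bcomp Phi -> pcomp R -> pcomp (fun p q => R (Phi p) q).
Proof.
  intros H HR. destruct (pcomp_comp _ _ (pcomp_total _ H) HR) as [e He].
  exists e. intros p q Hq. apply He. eauto.
Qed.

Lemma pcomp_post Phi R :
  bcomp Phi -> pcomp R -> pcomp (fun p r => exists q, R p q /\ r = Phi q).
Proof. intros H HR. exact (pcomp_comp _ _ HR (pcomp_total _ H)). Qed.

Lemma pcomp_pair (R T : baire -> baire -> Prop) :
  pcomp R -> pcomp T ->
  pcomp (fun p r => exists a b, R p a /\ T p b /\ r = spair a b).
Proof.
  intros [e He] [f Hf].
  (* Tabulate both computations with [cpair]; then select by a total operator. *)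
  assert (B : bcomp (fun p => spair (fun i => p1 (p i)) (fun i => p2 (p i)))).
  { apply (bcomp_spair (fun p i => p1 (p i)) (fun p i => p2 (p i))); bc. }
  destruct (pcomp_post _ _ B (pcomp_computed (cpair e f))) as [g Hg].
  exists g. intros p r (a & b & Ha & Hb & ->). apply Hg.
  exists (fun i => pr (a i) (b i)). split.
  - intros i. exists (a i), (b i). split; [exact (He _ _ Ha i)|].
    split; [exact (Hf _ _ Hb i)|reflexivity].
  - f_equal; extensionality i; [now rewrite p1_pr|now rewrite p2_pr].
Qed.

(** * Weihrauch reducibility *)

Lemma computable_computed e : computable (computed e).
Proof. now exists e. Qed.

Lemma w_le_intro (f g : mvmap) (H K : baire -> baire -> Prop) :
  pcomp H -> pcomp K ->
  (forall G : pfun, realizes G g -> forall p x, rep p x -> mdom f x ->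
     exists k s q y, K p k /\ G k s /\ H (spair p s) q /\ rep q y /\ f x y) ->
  w_le (Prob f) (Prob g).
Proof.
  intros [h Hh] [k Hk] R. exists (computed h), (computed k).
  repeat split; try apply computable_computed.
  intros G HG p x Hp Hx.
  destruct (R G HG p x Hp Hx) as (a & s & q & y & Ha & Hs & Hq & Hy & Hf).
  exists q, y. split; [|auto]. exists a, s. auto.
Qed.

Lemma w_le_top f : w_le f Top.
Proof. now destruct f. Qed.

Lemma w_le_trans f g h : w_le f g -> w_le g h -> w_le f h.
Proof.
  destruct h as [h|]; [|intros; apply w_le_top].
  destruct g as [g|]; [|intros _ []]. destruct f as [f|]; [|intros []].
  intros (H1 & K1 & CH1 & CK1 & R1) (H2 & K2 & CH2 & CK2 & R2).
  (* [H2] expects the instance of [g] next to the answer of [h], so the combined [H] recomputes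
     [K1 p] from the original input. *)
  apply w_le_intro with
    (H := fun r q => exists t, (exists a b, a = sfst r /\
       (exists u, (exists c d, (exists v, v = sfst r /\ K1 v c) /\
          d = ssnd r /\ u = spair c d) /\ H2 u b) /\ t = spair a b) /\ H1 t q)
    (K := fun p q => exists k, K1 p k /\ K2 k q).
  - apply pcomp_comp; [|assumption].
    apply pcomp_pair; [apply pcomp_total, bcomp_sfst, bcomp_id|].
    apply pcomp_comp; [|assumption].
    apply pcomp_pair; [|apply pcomp_total, bcomp_ssnd, bcomp_id].
    apply pcomp_comp; [|assumption]. apply pcomp_total, bcomp_sfst, bcomp_id.
  - now apply pcomp_comp.
  - intros G HG p x Hp Hx.
    destruct (R1 _ (R2 G HG) p x Hp Hx)
      as (q & y & (k & s & Hk & (k' & s' & Hk' & Hs' & Hs) & Hq) & Hy & Hf).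
    exists k', s', q, y. repeat split; eauto.
    exists (spair p s). split; [|assumption].
    exists p, s. rewrite sfst_spair, ssnd_spair. repeat split.
    exists (spair k s'). split; [|assumption].
    exists k, s'. repeat split. eauto.
Qed.

(** * Completion and parallelization *)

(** The point of completing: whatever a total translation outputs, it names a legitimate query or
    answer. *)
Lemma completion_rep_total (X : repspace) p :
  exists z : completion X, rep p z.
Proof.
  destruct (classic (exists x, precomp_rep X p x)) as [[x Hx]|N].
  - now exists (Some x).
  - now exists None.
Qed.

Lemma seq_completion_rep_total (X : repspace) p :
  exists z : seq_space (completion X), rep p z.
Proof.
  pose (c := fun i => constructive_indefinite_description _
    (completion_rep_total X (sproj i p))).
  exists (fun i => proj1_sig (c i)). intros i. exact (proj2_sig (c i)).
Qed.

Lemma completion_rep_dec (X : repspace) p q (z : completion X) :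
  (forall r, dec p r <-> dec q r) -> rep p z -> rep q z.
Proof.
  intros E. destruct z as [x|]; simpl.
  - intros (r & Hr & Hx). exists r. now rewrite <- E.
  - intros N (x & r & Hr & Hx). apply N. exists x, r. now rewrite E.
Qed.

Lemma mv_completion_total (f : mvmap) a : mdom (mv_completion f) a.
Proof.
  destruct (classic (exists x, a = Some x /\ mdom f x)) as [(x & -> & y & Hy)|N].
  - exists (Some y). left. eauto.
  - exists None. now right.
Qed.

Definition mv_pt (f : mvmap) : mvmap := mv_parallel (mv_completion f).

Lemma mv_pt_total (f : mvmap) x : mdom (mv_pt f) x.
Proof.
  pose (c := fun i => constructive_indefinite_description _
    (mv_completion_total f (x i))).
  exists (fun i => proj1_sig (c i)). intros i. exact (proj2_sig (c i)).
Qed.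

(** Supplies default answers when a realizer is prescribed on one query only. *)
Lemma mv_pt_realizer (f : mvmap) : exists g : baire -> baire,
  forall p x, rep p x -> exists y, rep (g p) y /\ mv_pt f x y.
Proof.
  apply (choice (fun p s => forall x, rep p x -> exists y, rep s y /\ mv_pt f x y)).
  intros p. destruct (seq_completion_rep_total (src f) p) as [x Hx].
  destruct (mv_pt_total f x) as [y Hy].
  destruct (rep_surjective (tgt (mv_pt f)) y) as [s Hs].
  exists s. intros x' Hx'.
  rewrite (rep_functional (seq_space (completion (src f))) p x' x Hx' Hx). eauto.
Qed.

(* A completed name of the sequence with all entries named by [b]. *)
Definition const_name (b : baire) : baire := fun n => S (b (p2 n)).

Lemma bcomp_const_name Phi : bcomp Phi -> bcomp (fun p => const_name (Phi p)).
Proof.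
  intros H. unfold const_name. apply bcomp_S, bcomp_app; [assumption|bc].
Qed.

Lemma sproj_const_name b i : sproj i (const_name b) = fun j => S (b j).
Proof. extensionality j. unfold sproj, const_name. now rewrite p2_pr. Qed.

Lemma rep_const_name (X : repspace) b (x : X) : rep b x ->
  @rep (seq_space (completion X)) (const_name b) (fun _ => Some x).
Proof.
  intros H i. simpl. rewrite sproj_const_name. exists b. auto using dec_succ.
Qed.

Lemma ptw_le_refl f : ptw_le f f.
Proof.
  destruct f as [f|]; [|exact I].
  apply w_le_intro with
    (H := fun r q => dec (sproj 0 (ssnd r)) q)
    (K := fun p k => k = const_name p).
  - apply pcomp_pre; [|apply pcomp_dec]. apply bcomp_sproj, bcomp_ssnd, bcomp_id.
  - apply pcomp_total, bcomp_const_name, bcomp_id.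
  - intros G HG p x Hp Hx.
    destruct (HG (const_name p) (fun _ => Some x)) as (s & y & Hs & Hy & Hf).
    + now apply rep_const_name.
    + apply mv_pt_total.
    + destruct (Hf 0) as [(x' & y' & [= <-] & E & Hy')|N].
      * specialize (Hy 0). rewrite E in Hy. destruct Hy as (q & Hq & Hr).
        exists (const_name p), s, q, y'. rewrite ssnd_spair. auto.
      * exfalso. apply N. eauto.
Qed.

Lemma delay_pcomp R : pcomp R ->
  exists D : baire -> baire, bcomp D /\
    forall p i k, R (scons i p) k ->
      forall r, dec (sproj i (D p)) r <-> dec k r.
Proof.
  intros [e He]. destruct dec_computable as [cd Hcd].
  assert (B : bcomp (fun p n => match p2 n with 0 => p1 n | S j => p j end)).
  { apply bcomp_match with (s := fun p _ j => p j); bc. }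
  destruct B as [c Hc].
  (* The inner substitution lets [e] read [scons i p], rebuilt by [c] from the parameter [i]; the
     outer one feeds its output to the decoder. Decoding comes first because [k] is itself a
     completed name, whose letters are emitted afresh. *)
  destruct (delay_computable (psubst (psubst c e) cd)) as (D & BD & HD).
  exists D. split; [assumption|]. intros p i k Hk r. rewrite HD, Hcd.
  assert (E : forall m v, eval p (psubst (psubst c e) cd) (pr i m) v <->
                          eval k cd m v); [|split; intros Q m; apply E, Q].
  intros m v. apply eval_psubst. intros n. apply (eval_psubst _ _ _ (scons i p)).
  - intros n'. specialize (Hc p (pr i n')). now rewrite p1_pr, p2_pr in Hc.
  - exact (He _ _ Hk n).
Qed.

Lemma bcomp_sproj_dyn N Phi : bcomp N -> bcomp Phi ->
  bcomp (fun p => sproj (N p 0) (Phi p)).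
Proof.
  intros HN H. unfold sproj. apply bcomp_app; [assumption|].
  apply bcomp_pr; [|bc]. apply bcomp_app; bc.
Qed.

(** Regroups the entries [<i, j>] of a sequence, for fixed [i], into the [i]-th of countably many
    interleaved sequences. *)
Definition slice (i : nat) (s : baire) : baire :=
  fun n => s (pr (pr i (p1 n)) (p2 n)).

Lemma bcomp_slice_dyn N Phi : bcomp N -> bcomp Phi ->
  bcomp (fun p => slice (N p 0) (Phi p)).
Proof.
  intros HN H. unfold slice. apply bcomp_app; [assumption|].
  apply bcomp_pr; [|bc]. apply bcomp_pr; [|bc]. apply bcomp_app; bc.
Qed.

Lemma sproj_slice i j s : sproj j (slice i s) = sproj (pr i j) s.
Proof. extensionality n. unfold sproj, slice. now rewrite p1_pr, p2_pr. Qed.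

(* Both halves of the reduction are made total by [delay_pcomp]: the [i]-th
   instance of [g] is served by the instances [<i, j>] of [h], and an [i]-th
   instance outside the domain of [g] still yields some completed names. *)
Lemma w_le_pt g h : w_le g (p_pt h) -> w_le (p_pt g) (p_pt h).
Proof.
  destruct h as [h|]; [|intros; apply w_le_top].
  destruct g as [g|]; [|intros []].
  intros (H & K & CH & CK & R). change (p_pt (Prob h)) with (Prob (mv_pt h)) in *.
  (* Here [P] is [scons <i, j> p]: the [i]-th instance in [p] is decoded, [K] turns it into a
     sequence of queries, and the [j]-th of them becomes row [<i, j>]. *)
  destruct (delay_pcomp (fun P k => exists t,
    (exists a b, (exists x, dec (sproj (p1 (P 0)) (stail P)) x /\ K x a) /\
      b = P /\ t = spair a b) /\ k = sproj (p2 (ssnd t 0)) (sfst t)))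
    as (DK & BDK & HDK).
  { apply pcomp_post.
    { apply (bcomp_sproj_dyn (fun t n => p2 (ssnd t n))).
      - apply bcomp_p2, bcomp_ssnd, bcomp_id.
      - apply bcomp_sfst, bcomp_id. }
    apply pcomp_pair; [|apply pcomp_total, bcomp_id].
    apply pcomp_comp; [|assumption].
    apply (pcomp_pre (fun P => sproj (p1 (P 0)) (stail P))); [|apply pcomp_dec].
    apply (bcomp_sproj_dyn (fun P n => p1 (P n))); [bc|].
    apply bcomp_stail, bcomp_id. }
  (* Here [P] is [scons i <p, s>]: [H] receives the decoded [i]-th instance and the answers
     belonging to it; the successor makes its result a completed name. *)
  destruct (delay_pcomp (fun P k => exists q, (exists t,
    (exists a b, dec (sproj (P 0) (sfst (stail P))) a /\
      b = slice (P 0) (ssnd (stail P)) /\ t = spair a b) /\ H t q) /\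
    k = fun i => S (q i))) as (DH & BDH & HDH).
  { apply pcomp_post; [bc|]. apply pcomp_comp; [|assumption].
    apply pcomp_pair.
    - apply (pcomp_pre (fun P => sproj (P 0) (sfst (stail P)))); [|apply pcomp_dec].
      apply (bcomp_sproj_dyn (fun P => P)); [bc|].
      apply bcomp_sfst, bcomp_stail, bcomp_id.
    - apply pcomp_total, (bcomp_slice_dyn (fun P => P)); [bc|].
      apply bcomp_ssnd, bcomp_stail, bcomp_id. }
  apply w_le_intro with (g := mv_pt h) (f := mv_pt g)
    (H := fun r q => q = DH r) (K := fun p k => k = DK p);
    [now apply pcomp_total..|].
  intros G HG p x Hp _.
  destruct (seq_completion_rep_total (src h) (DK p)) as [z Hz].
  destruct (HG (DK p) z Hz (mv_pt_total h z)) as (s & w & Hs & Hw & Hzw).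
  destruct (seq_completion_rep_total (tgt g) (DH (spair p s))) as [y Hy].
  exists (DK p), s, (DH (spair p s)), y. repeat split; auto.
  intros i. destruct (classic (exists x0, x i = Some x0 /\ mdom g x0))
    as [(x0 & Ex & D0)|N]; [left|now right].
  pose proof (Hp i) as Hpi. rewrite Ex in Hpi. destruct Hpi as (x' & Hx' & Hx0).
  destruct (mv_pt_realizer h) as [g0 Hg0].
  (* A realizer that answers [K x'] with the [i]-th slice of [s]. *)
  assert (G' : exists G' : pfun, forall k s', G' k s' <->
    (K x' k /\ s' = slice i s \/ ~ K x' k /\ s' = g0 k)).
  { unshelve eexists; [refine (Pfun (fun k s' =>
      K x' k /\ s' = slice i s \/ ~ K x' k /\ s' = g0 k) _)|reflexivity].
    intros k q q' [[A ->]|[A ->]] [[A' ->]|[A' ->]]; tauto. }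
  destruct G' as [G' HG'].
  destruct (R G') with (p := x') (x := x0)
    as (q & y0 & (k & s' & Hk & Hs' & Hq) & Hqy & Hgy); auto.
  { intros k v Hv _. destruct (classic (K x' k)) as [A|A].
    - exists (slice i s), (fun j => w (pr i j)). rewrite HG'.
      split; [auto|]. split.
      + intros j. simpl. rewrite sproj_slice. apply Hw.
      (* Entry [j] of [k] and row [<i, j>] of [DK p] decode alike, hence name the same point, even
         when that point is bottom. *)
      + intros j. replace (v j) with (z (pr i j)); [apply Hzw|].
        apply (rep_functional (completion (src h)) (sproj (pr i j) (DK p)));
          [apply Hz|].
        apply (completion_rep_dec _ (sproj j k)); [|apply Hv].
        intros r. symmetry. apply HDK.
        exists (spair k (scons (pr i j) p)). split.
        * exists k, (scons (pr i j) p). repeat split.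
          exists x'. split; [|assumption]. simpl. now rewrite p1_pr.
        * rewrite ssnd_spair, sfst_spair. simpl. now rewrite p2_pr.
    - destruct (Hg0 k v Hv) as (y1 & Hy1 & Hf1).
      exists (g0 k), y1. rewrite HG'. auto. }
  apply HG' in Hs'. destruct Hs' as [[_ ->]|[A _]]; [|tauto].
  exists x0, y0. split; [assumption|]. split; [|assumption].
  apply (rep_functional (completion (tgt g)) (sproj i (DH (spair p s))));
    [apply Hy|].
  exists q. split; [|assumption].
  apply HDH with (k := fun n => S (q n)); [|apply dec_succ].
  exists q. split; [|reflexivity].
  exists (spair x' (slice i s)). split; [|assumption].
  exists x', (slice i s). change (stail (scons i (spair p s))) with (spair p s).
  now rewrite sfst_spair, ssnd_spair.
Qed.

Lemma ptw_le_trans f g h : ptw_le f g -> ptw_le g h -> ptw_le f h.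
Proof. intros H H'. exact (w_le_trans _ _ _ H (w_le_pt _ _ H')). Qed.

Lemma w_le_ptw_le f g : w_le f g -> ptw_le f g.
Proof. intros H. exact (w_le_trans _ _ _ H (ptw_le_refl g)). Qed.

Lemma ptw_le_top f : ptw_le f Top.
Proof. apply w_le_top. Qed.

(** * Medvedev reducibility *)

Lemma med_le_pcomp (A B : baire -> Prop) :
  med_le A B <-> exists E, pcomp E /\ forall p, B p -> exists q, E p q /\ A q.
Proof.
  split.
  - intros (F & CF & D & R). exists F. split; [exact CF|].
    intros p Hp. destruct (D p Hp) as [q Hq]. eauto.
  - intros (E & [e He] & R). exists (computed e).
    split; [apply computable_computed|]. split.
    + intros p Hp. destruct (R p Hp) as (q & Hq & _). exists q. auto.
    + intros p q Hp Hq. destruct (R p Hp) as (q' & Hq' & Ha).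
      now rewrite (graph_functional _ _ _ _ Hq (He _ _ Hq')).
Qed.

Lemma med_le_refl A : med_le A A.
Proof.
  apply med_le_pcomp. exists (fun p q => q = p).
  split; [apply pcomp_total, bcomp_id|eauto].
Qed.

Lemma med_le_trans A B C : med_le A B -> med_le B C -> med_le A C.
Proof.
  rewrite !med_le_pcomp. intros (E & HE & R) (E' & HE' & R').
  exists (fun p r => exists q, E' p q /\ E q r). split; [now apply pcomp_comp|].
  intros p Hp. destruct (R' p Hp) as (q & Hq & Bq).
  destruct (R q Bq) as (r & Hr & Ar). eauto.
Qed.

(** * Constant problems *)

Definition mv_const (A : baire -> Prop) : mvmap :=
  Mvmap baire_space baire_space (fun _ q => A q).

Lemma p_const_nonempty (A : baire -> Prop) :
  (exists q, A q) -> p_const A = Prob (mv_const A).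
Proof.
  intros H. unfold p_const. now destruct (excluded_middle_informative _).
Qed.

Lemma p_const_empty (A : baire -> Prop) : ~ (exists q, A q) -> p_const A = Top.
Proof.
  intros H. unfold p_const. now destruct (excluded_middle_informative _).
Qed.

Definition ones : baire := fun _ => 1.

Lemma rep_ones : @rep (seq_space (completion baire_space)) ones
  (fun _ => Some (fun _ : nat => 0)).
Proof. exact (rep_const_name baire_space (fun _ => 0) _ eq_refl). Qed.

Lemma mv_pt_const_some (A : baire -> Prop) a x :
  A a -> mv_pt (mv_const A) x (fun _ => Some a).
Proof.
  intros Ha i. destruct (x i) as [u|] eqn:E; [left; eauto 6|right].
  intros (u & [=] & _).
Qed.

(** The query has to be a genuine point in the domain, which nonemptiness of [A] ensures: at bottom
    the completion admits every answer. *)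
Lemma mv_pt_const_answer (A : baire -> Prop) (HA : exists a, A a) s y i :
  @rep (tgt (mv_pt (mv_const A))) s y ->
  mv_pt (mv_const A) (fun _ => Some (fun _ : nat => 0)) y ->
  exists a, dec (sproj i s) a /\ A a.
Proof.
  intros Hs Hy. destruct (Hy i) as [(x & a & _ & E & Ha)|N].
  - specialize (Hs i). rewrite E in Hs. destruct Hs as (q & Hq & Er).
    simpl in Er. subst. eauto.
  - exfalso. apply N. eauto.
Qed.

(** The form of all upper bounds by a constant problem: solutions must be computed from the input
    and one unknown [b] in [B], which is read off entry [0] of the answer to [ones]. *)
Lemma ptw_le_const (f : mvmap) (B : baire -> Prop) E :
  pcomp E ->
  (forall b p x, B b -> rep p x -> mdom f x ->
     exists q y, E (spair p b) q /\ rep q y /\ f x y) ->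
  ptw_le (Prob f) (p_const B).
Proof.
  intros HE R. destruct (classic (exists b, B b)) as [HB|HB];
    [|rewrite (p_const_empty B HB); apply ptw_le_top].
  rewrite (p_const_nonempty B HB).
  apply w_le_intro with (g := mv_pt (mv_const B))
    (K := fun _ k => k = ones)
    (H := fun r q => exists t, (exists a b, a = sfst r /\
            dec (sproj 0 (ssnd r)) b /\ t = spair a b) /\ E t q).
  - apply pcomp_comp; [|assumption].
    apply pcomp_pair; [apply pcomp_total, bcomp_sfst, bcomp_id|].
    apply pcomp_pre; [|apply pcomp_dec]. apply bcomp_sproj, bcomp_ssnd, bcomp_id.
  - apply (pcomp_total (fun _ => ones)), (bcomp_cst 1).
  - intros G HG p x Hp Hx.
    destruct (HG _ _ rep_ones (mv_pt_total _ _)) as (s & y & Hs & Hsy & Hy).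
    destruct (mv_pt_const_answer B HB s y 0 Hsy Hy) as (b & Hb & Bb).
    destruct (R b p x Bb Hp Hx) as (q & z & Hq & Hqz & Hz).
    exists ones, s, q, z. rewrite sfst_spair, ssnd_spair. repeat split; auto.
    exists (spair p b). split; [|assumption]. exists p, b. auto.
Qed.

(** The dual tool for lower bounds: [p_const A] disregards its input, so one computable instance
    [k0] can be asked every time. *)
Lemma const_w_le (A : baire -> Prop) (g : mvmap) E k0 x0 :
  (exists a, A a) -> pcomp E -> bcomp (fun _ => k0) ->
  @rep (src g) k0 x0 -> mdom g x0 ->
  (forall q y, rep q y -> g x0 y -> exists a, E q a /\ A a) ->
  w_le (p_const A) (Prob g).
Proof.
  intros HA HE Hk0 Hx0 D R. rewrite (p_const_nonempty A HA).
  apply w_le_intro with (K := fun _ k => k = k0) (H := fun r q => E (ssnd r) q).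
  - apply pcomp_pre; [apply bcomp_ssnd, bcomp_id|assumption].
  - apply (pcomp_total (fun _ => k0)), Hk0.
  - intros G HG p x Hp Hx. destruct (HG k0 x0 Hx0 D) as (s & y & Hs & Hsy & Hy).
    destruct (R s y Hsy Hy) as (a & Ha & Aa).
    exists k0, s, a, a. rewrite ssnd_spair. repeat split; auto.
Qed.

Lemma med_le_ptw_le A B : med_le A B <-> ptw_le (p_const A) (p_const B).
Proof.
  destruct (classic (exists b, B b)) as [HB|HB].
  2:{ rewrite (p_const_empty B HB). split; [intros; apply ptw_le_top|intros _].
      apply med_le_pcomp. exists (fun p q => q = p).
      split; [apply pcomp_total, bcomp_id|]. intros p Hp. exfalso. eauto. }
  rewrite med_le_pcomp. split.
  - intros (E & HE & R).
    assert (HA : exists a, A a).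
    { destruct HB as [b Hb]. destruct (R b Hb) as (a & _ & Ha). eauto. }
    rewrite (p_const_nonempty A HA).
    apply ptw_le_const with (E := fun r q => E (ssnd r) q).
    + apply pcomp_pre; [apply bcomp_ssnd, bcomp_id|assumption].
    + intros b p x Hb _ _. destruct (R b Hb) as (a & Ha & Aa).
      exists a, a. rewrite ssnd_spair. repeat split; auto.
  - destruct (classic (exists a, A a)) as [HA|HA];
      [rewrite (p_const_nonempty A HA)|rewrite (p_const_empty A HA)];
      rewrite (p_const_nonempty B HB); [|intros []].
    intros (H & K & CH & CK & R).
    (* The zero stream is the fixed instance; [const_name b] stands for the answer of the realizer
       [G], whatever [K] asks. *)
    exists (fun b q => H (spair (fun _ => 0) (const_name b)) q). split.
    + apply (pcomp_pre (fun b => spair (fun _ => 0) (const_name b))); [|assumption].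
      apply (bcomp_spair (fun _ _ => 0)); [bc|].
      apply bcomp_const_name, bcomp_id.
    + intros b Hb.
      pose (G := Pfun (fun _ s => s = const_name b)
                   (fun _ _ _ e e' => eq_trans e (eq_sym e'))).
      destruct (R G) with (p := fun _ : nat => 0) (x := fun _ : nat => 0)
        as (q & y & (k & s & Hk & Hs & Hq) & Hy & Ay).
      * intros k x Hx _. exists (const_name b), (fun _ => Some b).
        split; [reflexivity|]. split.
        -- now apply (rep_const_name baire_space).
        -- now apply mv_pt_const_some.
      * reflexivity.
      * exact HA.
      * simpl in Hs, Hy. subst. eauto.
Qed.

(** * Degrees *)

Lemma deg_class_eq {T : Type} (le : T -> T -> Prop)
  (le_refl : forall a, le a a)
  (le_trans : forall a b c, le a b -> le b c -> le a c) a b :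
  deg_class le a = deg_class le b <-> le a b /\ le b a.
Proof.
  split.
  - intros E. change (deg_class le a b). rewrite E. split; apply le_refl.
  - intros [H H']. extensionality c. apply propositional_extensionality.
    unfold deg_class. split; intros [H1 H2]; split; eauto.
Qed.

Lemma degree_eq {T : Type} (le : T -> T -> Prop) (d d' : degree le) :
  proj1_sig d = proj1_sig d' -> d = d'.
Proof.
  destruct d as [D H], d' as [D' H']. simpl. intros ->. f_equal.
  apply proof_irrelevance.
Qed.

Lemma deg_eq {T : Type} (le : T -> T -> Prop)
  (le_refl : forall a, le a a)
  (le_trans : forall a b c, le a b -> le b c -> le a c) a b :
  deg le a = deg le b <-> le a b /\ le b a.
Proof.
  rewrite <- (deg_class_eq le le_refl le_trans). split.
  - intros E. exact (f_equal (@proj1_sig _ _) E).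
  - intros E. now apply degree_eq.
Qed.

Lemma deg_surjective {T : Type} (le : T -> T -> Prop) (d : degree le) :
  exists a, d = deg le a.
Proof.
  destruct d as [D [a Ha]]. exists a. now apply degree_eq.
Qed.

Lemma wdeg_eq f g : wdeg f = wdeg g <-> ptw_le f g /\ ptw_le g f.
Proof. apply deg_eq; [exact ptw_le_refl|exact ptw_le_trans]. Qed.

Lemma mdeg_eq A B : mdeg A = mdeg B <-> med_le A B /\ med_le B A.
Proof. apply deg_eq; [exact med_le_refl|exact med_le_trans]. Qed.

(** * Preservation of the operations *)

Lemma wdeg_pt f : wdeg (p_pt f) = wdeg f.
Proof.
  apply wdeg_eq. split; [|apply w_le_ptw_le, ptw_le_refl].
  exact (w_le_pt f f (ptw_le_refl f)).
Qed.

Lemma wdeg_const_eq A B : mdeg A = mdeg B -> wdeg (p_const A) = wdeg (p_const B).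
Proof. rewrite mdeg_eq, wdeg_eq, <- !med_le_ptw_le. auto. Qed.

(** * Infima *)

Lemma med_otimes_empty_l (A B : baire -> Prop) :
  ~ (exists a, A a) -> mdeg (med_otimes A B) = mdeg B.
Proof.
  intros HA. apply mdeg_eq. rewrite !med_le_pcomp. split.
  - exists (fun p q => q = scons 1 p). split.
    + apply pcomp_total, (bcomp_scons (fun _ _ => 1)); [bc|apply bcomp_id].
    + intros p Hp. eexists. split; [reflexivity|]. right. eauto.
  - exists (fun p q => q = stail p).
    split; [apply pcomp_total, bcomp_stail, bcomp_id|].
    intros p [(a & Ha & _)|(b & Hb & ->)]; [exfalso; eauto|]. eauto.
Qed.

Lemma med_otimes_empty_r (A B : baire -> Prop) :
  ~ (exists b, B b) -> mdeg (med_otimes A B) = mdeg A.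
Proof.
  intros HB. apply mdeg_eq. rewrite !med_le_pcomp. split.
  - exists (fun p q => q = scons 0 p). split.
    + apply pcomp_total, (bcomp_scons (fun _ _ => 0)); [bc|apply bcomp_id].
    + intros p Hp. eexists. split; [reflexivity|]. left. eauto.
  - exists (fun p q => q = stail p).
    split; [apply pcomp_total, bcomp_stail, bcomp_id|].
    intros p [(a & Ha & ->)|(b & Hb & _)]; [|exfalso; eauto]. eauto.
Qed.

Lemma wdeg_const_otimes A B :
  wdeg (p_const (med_otimes A B)) = wdeg (ptw_inf (p_const A) (p_const B)).
Proof.
  unfold ptw_inf. destruct (classic (exists a, A a)) as [HA|HA].
  (* [Top] is neutral for [p_inf], as the empty set is for [med_otimes]. *)
  2:{ rewrite (p_const_empty A HA).
      change (p_inf (p_pt Top) (p_pt (p_const B))) with (p_pt (p_const B)).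
      rewrite wdeg_pt. now apply wdeg_const_eq, med_otimes_empty_l. }
  rewrite (p_const_nonempty A HA). destruct (classic (exists b, B b)) as [HB|HB].
  2:{ rewrite (p_const_empty B HB).
      change (p_inf (p_pt (Prob (mv_const A))) (p_pt Top)) with
        (p_pt (Prob (mv_const A))).
      rewrite wdeg_pt, <- (p_const_nonempty A HA).
      now apply wdeg_const_eq, med_otimes_empty_r. }
  rewrite (p_const_nonempty B HB).
  change (p_inf (p_pt (Prob (mv_const A))) (p_pt (Prob (mv_const B)))) with
    (Prob (mv_inf (mv_pt (mv_const A)) (mv_pt (mv_const B)))).
  apply wdeg_eq. split.
  - apply w_le_ptw_le.
    (* Both halves of [ones] are again [ones], so it names the pair [x0]. The answer is a side tag
       followed by a sequence of completed names; the tag is kept and entry [0] decoded. *)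
    apply const_w_le with (k0 := ones)
      (x0 := (fun _ => Some (fun _ : nat => 0), fun _ => Some (fun _ : nat => 0)))
      (E := fun r q => exists t, (exists a b, dec (sproj 0 (stail r)) a /\
         b = r /\ t = spair a b) /\ q = scons (ssnd t 0) (sfst t)).
    + destruct HA as [a Ha]. exists (scons 0 a). left. eauto.
    + apply pcomp_post.
      * apply (bcomp_scons (fun t => ssnd t)); [apply bcomp_ssnd, bcomp_id|].
        apply bcomp_sfst, bcomp_id.
      * apply pcomp_pair; [|apply pcomp_total, bcomp_id].
        apply pcomp_pre; [|apply pcomp_dec]. apply bcomp_sproj, bcomp_stail, bcomp_id.
    + exact (bcomp_cst 1).
    + split; exact rep_ones.
    + destruct (mv_pt_total (mv_const A) (fun _ => Some (fun _ : nat => 0))) as [y Hy].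
      exists (inl y). split; [apply mv_pt_total|]. split; [apply mv_pt_total|exact Hy].
    + intros q [y|y] [Hq0 Hq] (_ & _ & Hy); simpl in Hy.
      * destruct (mv_pt_const_answer A HA _ y 0 Hq Hy) as (a & Ha & Aa).
        exists (scons 0 a). split; [|left; eauto].
        exists (spair a q). rewrite ssnd_spair, sfst_spair, Hq0.
        split; [|reflexivity]. exists a, q. auto.
      * destruct (mv_pt_const_answer B HB _ y 0 Hq Hy) as (a & Ha & Aa).
        exists (scons 1 a). split; [|right; eauto].
        exists (spair a q). rewrite ssnd_spair, sfst_spair, Hq0.
        split; [|reflexivity]. exists a, q. auto.
  (* An element of [med_otimes A B] already carries the side; its tail, repeated as a constant
     sequence, answers that side for every instance. *)
  - apply ptw_le_const with
      (E := fun r q => q = scons (ssnd r 0) (const_name (stail (ssnd r)))).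
    + apply pcomp_total, (bcomp_scons (fun r => ssnd r));
        [apply bcomp_ssnd, bcomp_id|].
      apply bcomp_const_name, bcomp_stail, bcomp_ssnd, bcomp_id.
    + intros r p [x u] Hr _ _. rewrite ssnd_spair.
      exists (scons (r 0) (const_name (stail r))).
      destruct Hr as [(a & Ha & ->)|(a & Ha & ->)].
      * exists (inl (fun _ => Some a)). split; [reflexivity|]. split.
        -- split; [reflexivity|]. now apply (rep_const_name baire_space a a).
        -- split; [apply mv_pt_total|]. split; [apply mv_pt_total|].
           now apply mv_pt_const_some.
      * exists (inr (fun _ => Some a)). split; [reflexivity|]. split.
        -- split; [reflexivity|]. now apply (rep_const_name baire_space a a).
        -- split; [apply mv_pt_total|]. split; [apply mv_pt_total|].
           now apply mv_pt_const_some.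
Qed.

(** * Suprema *)

Lemma wdeg_const_oplus A B :
  wdeg (p_const (med_oplus A B)) = wdeg (p_sup (p_const A) (p_const B)).
Proof.
  destruct (classic (exists a, A a)) as [HA|HA].
  2:{ rewrite (p_const_empty A HA), p_const_empty; [reflexivity|].
      intros (r & a & b & Ha & _). eauto. }
  destruct (classic (exists b, B b)) as [HB|HB].
  2:{ rewrite (p_const_empty B HB), p_const_empty.
      - now destruct (p_const A).
      - intros (r & a & b & _ & Hb & _). eauto. }
  rewrite (p_const_nonempty A HA), (p_const_nonempty B HB).
  change (p_sup (Prob (mv_const A)) (Prob (mv_const B))) with
    (Prob (mv_sup (mv_const A) (mv_const B))).
  apply wdeg_eq. split.
  (* One instance of the supremum yields a solution on one side only, so a sequence is asked: entry
     [0] on the left, all others on the right. Entries [0] and [1] of the answer, stripped of their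
     tags, form the pair. *)
  - set (z := fun _ : nat => 0).
    set (tag := fun i => match i with 0 => 0 | S _ => 1 end).
    apply const_w_le with (g := mv_pt (mv_sup (mv_const A) (mv_const B)))
      (k0 := fun n => S (scons (tag (p1 n)) z (p2 n)))
      (x0 := fun i => Some match i with 0 => inl z | S _ => inr z end)
      (E := fun r q => exists t, (exists a b, dec (sproj 0 r) a /\
              dec (sproj 1 r) b /\ t = spair a b) /\
            q = spair (stail (sfst t)) (stail (ssnd t))).
    + destruct HA as [a Ha], HB as [b Hb]. exists (spair a b), a, b. auto.
    + apply pcomp_post.
      * apply bcomp_spair; apply bcomp_stail;
          [apply bcomp_sfst|apply bcomp_ssnd]; apply bcomp_id.
      * apply pcomp_pair; (apply pcomp_pre; [apply bcomp_sproj, bcomp_id|]);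
          apply pcomp_dec.
    + apply bcomp_S. unfold scons.
      apply bcomp_match with (s := fun _ _ _ => 0); [bc| |bc].
      apply bcomp_match with (s := fun _ _ _ => 1); bc.
    + intros i. exists (scons (tag i) z). split.
      * replace (sproj i _) with (fun j => S (scons (tag i) z j));
          [apply dec_succ|].
        extensionality j. unfold sproj. now rewrite p1_pr, p2_pr.
      * destruct i; split; reflexivity.
    + apply mv_pt_total.
    + intros q y Hq Hy.
      destruct (Hy 0) as [(x & v & [= <-] & E0 & H0)|N].
      2:{ exfalso. apply N. exists (inl z). split; [reflexivity|].
          destruct HA as [a Ha]. now exists (inl a). }
      destruct (Hy 1) as [(x & w & [= <-] & E1 & H1)|N].
      2:{ exfalso. apply N. exists (inr z). split; [reflexivity|].
          destruct HB as [b Hb]. now exists (inr b). }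
      destruct v as [a|a]; [|destruct H0]. destruct w as [b|b]; [destruct H1|].
      pose proof (Hq 0) as Q0. pose proof (Hq 1) as Q1.
      rewrite E0 in Q0. rewrite E1 in Q1.
      destruct Q0 as (a' & Da & _ & Ra), Q1 as (b' & Db & _ & Rb).
      simpl in Ra, Rb. exists (spair a b). split; [|exists a, b; auto].
      exists (spair a' b'). rewrite sfst_spair, ssnd_spair, Ra, Rb.
      split; [|reflexivity]. exists a', b'. auto.
  (* The tag of the instance, [sfst r 0], selects the half of the pair and becomes the tag of the
     answer. *)
  - apply ptw_le_const with (E := fun r q => q = scons (sfst r 0)
      (fun i => match sfst r 0 with 0 => sfst (ssnd r) i | S _ => ssnd (ssnd r) i end)).
    + apply pcomp_total, (bcomp_scons (fun r => sfst r));
        [apply bcomp_sfst, bcomp_id|].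
      apply bcomp_match with (s := fun r i _ => ssnd (ssnd r) i).
      * apply (bcomp_app (fun _ _ => 0) (fun r => sfst r));
          [apply bcomp_sfst, bcomp_id|bc].
      * apply bcomp_sfst, bcomp_ssnd, bcomp_id.
      * apply (bcomp_app (fun _ m => p1 m) (fun r => ssnd (ssnd r)));
          [apply bcomp_ssnd, bcomp_ssnd, bcomp_id|bc].
    + intros r p x (a & b & Ha & Hb & ->) Hp _.
      rewrite sfst_spair, !ssnd_spair, sfst_spair.
      destruct x as [x|x]; destruct Hp as [E _]; rewrite E.
      * eexists. exists (inl a). repeat split. exact Ha.
      * eexists. exists (inr b). repeat split. exact Hb.
Qed.

(** * The bottom degree *)

Lemma wdeg_const_true : wdeg (p_const (fun _ => True)) = wdeg p_id.
Proof.
  assert (HT : exists a : baire, True) by now exists ones.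
  apply wdeg_eq. split.
  - apply w_le_ptw_le.
    apply const_w_le with (k0 := ones) (x0 := ones) (E := fun p q => q = p);
      [exact HT|apply pcomp_total, bcomp_id|exact (bcomp_cst 1)|reflexivity| |].
    + now exists ones.
    + eauto.
  - apply ptw_le_const with (E := fun r q => q = sfst r);
      [apply pcomp_total, bcomp_sfst, bcomp_id|].
    intros b p x _ Hp _. exists p, p. rewrite sfst_spair.
    simpl in Hp. now subst.
Qed.

(** Completion makes the nowhere defined problem total, so it answers the query [ones], and any
    answer solves the full set. This matches the value [p_zero] of an implication out of [Top]. *)
Lemma wdeg_zero : wdeg p_zero = wdeg (p_const (fun _ => True)).
Proof.
  assert (HT : exists a : baire, True) by now exists ones.
  apply wdeg_eq. split.
  - apply ptw_le_const with (E := fun r q => q = r);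
      [apply pcomp_total, bcomp_id|]. intros b p x _ _ [y []].
  - apply const_w_le with
      (g := mv_pt (Mvmap baire_space baire_space (fun _ _ => False)))
      (k0 := ones) (x0 := fun _ => Some (fun _ : nat => 0))
      (E := fun p q => q = p);
      [exact HT|apply pcomp_total, bcomp_id|exact (bcomp_cst 1)|exact rep_ones| |].
    + apply mv_pt_total.
    + eauto.
Qed.

(** * The implication *)

Lemma mv_r_pt (f : mvmap) p s :
  mv_r (mv_pt f) p s <-> exists x y, rep p x /\ rep s y /\ mv_pt f x y.
Proof.
  unfold mv_r, mcomp. split.
  - intros (_ & y & (_ & x & Hx & Hf) & Hs). eauto.
  - intros (x & y & Hx & Hs & Hf). split.
    + intros y' _. apply (rep_surjective (tgt (mv_pt f))).
    + exists y. split; [|assumption]. split; [intros; apply mv_pt_total|eauto].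
Qed.

Lemma mv_r_pt_const (A : baire -> Prop) p a :
  A a -> mv_r (mv_pt (mv_const A)) p (const_name a).
Proof.
  intros Ha. destruct (seq_completion_rep_total baire_space p) as [x Hx].
  apply mv_r_pt. exists x, (fun _ => Some a). split; [exact Hx|]. split.
  - now apply (rep_const_name baire_space).
  - now apply mv_pt_const_some.
Qed.

Lemma mv_r_pt_ones (A : baire -> Prop) (HA : exists a, A a) s :
  mv_r (mv_pt (mv_const A)) ones s -> exists a, dec (sproj 0 s) a /\ A a.
Proof.
  intros H. apply mv_r_pt in H. destruct H as (x & y & Hx & Hs & Hy).
  rewrite (rep_functional _ _ _ _ Hx rep_ones) in Hy.
  exact (mv_pt_const_answer A HA s y 0 Hs Hy).
Qed.

Lemma phi_index (phi : nat -> pfun) (Hphi : goedel_numbering phi) R :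
  pcomp R -> exists n, forall p q, R p q -> phi n p q.
Proof.
  intros [e He]. destruct (gn_complete _ Hphi e) as [n Hn].
  exists n. intros p q H. apply Hn, He, H.
Qed.

Lemma pcomp_phi (phi : nat -> pfun) (Hphi : goedel_numbering phi) :
  pcomp (fun r q => phi (r 0) (stail r) q).
Proof.
  destruct (gn_utm _ Hphi) as [u Hu]. exists u. intros r q H. apply Hu in H.
  replace r with (scons (r 0) (stail r)); [exact H|].
  now extensionality i; destruct i.
Qed.

(** The program returns the attached [q], chosen in [A]. This keeps the constant problem of the
    implication away from [Top] and gives [mv_mimp] a value at every input. *)
Lemma med_imp_nonempty (phi : nat -> pfun) (Hphi : goedel_numbering phi)
  (A B : baire -> Prop) :
  (exists a, A a) -> exists r, med_imp phi B A r.
Proof.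
  intros [a Ha].
  destruct (phi_index phi Hphi (fun p q => q = sfst p)) as [n Hn];
    [apply pcomp_total, bcomp_sfst, bcomp_id|].
  exists (scons n a), n, a. split; [reflexivity|].
  intros p _. exists a. split; [|assumption]. apply Hn. now rewrite sfst_spair.
Qed.

(** The given [r] travels as the third component, so [n] and [k] do not depend on it: [k] always
    asks [ones], whose every answer decodes to an element of [B], and [n] returns the outcome as a
    constant sequence, valid for any instance. *)
Lemma mv_mimp_of_med_imp (phi : nat -> pfun) (Hphi : goedel_numbering phi)
  (A B : baire -> Prop) :
  (exists b, B b) ->
  exists n k, forall p r, med_imp phi B A r ->
    mv_mimp phi (mv_pt (mv_const B)) (mv_pt (mv_const A)) p
      (scons n (scons k r)).
Proof.
  intros HB.
  destruct (phi_index phi Hphi (fun _ q => q = ones)) as [k Hk];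
    [exact (pcomp_total (fun _ => ones) (bcomp_cst 1))|].
  (* [P] is [<r, s>] with [r] encoding [<m, q>]: an element [b] is decoded from the answer [s], and
     the universal program runs [m] on [<q, b>]. *)
  destruct (phi_index phi Hphi (fun P q => exists z, (exists w,
    (exists a b, a = sfst P /\ dec (sproj 0 (ssnd P)) b /\ w = spair a b) /\
      phi (sfst w 0) (spair (stail (sfst w)) (ssnd w)) z) /\ q = const_name z))
    as [n Hn].
  { apply pcomp_post; [apply bcomp_const_name, bcomp_id|].
    apply pcomp_comp.
    - apply pcomp_pair; [apply pcomp_total, bcomp_sfst, bcomp_id|].
      apply pcomp_pre; [|apply pcomp_dec]. apply bcomp_sproj, bcomp_ssnd, bcomp_id.
    - apply (pcomp_pre
        (fun w => scons (sfst w 0) (spair (stail (sfst w)) (ssnd w))) _)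
        with (2 := pcomp_phi phi Hphi).
      apply (bcomp_scons (fun w => sfst w)); [apply bcomp_sfst, bcomp_id|].
      apply bcomp_spair; [apply bcomp_stail, bcomp_sfst|apply bcomp_ssnd];
        apply bcomp_id. }
  exists n, k. intros p r (m & q & -> & Hr). exists n, k, (scons m q).
  split; [reflexivity|]. cbv zeta.
  assert (Ek : forall y, phi k p y -> y = ones).
  { intros y Hy. exact (graph_functional _ _ _ _ Hy (Hk p ones eq_refl)). }
  assert (Q : forall s, mv_r (mv_pt (mv_const B)) ones s ->
            exists a, A a /\ phi n (spair (scons m q) s) (const_name a)).
  { intros s Hs. destruct (mv_r_pt_ones B HB s Hs) as (b & Hb & Bb).
    destruct (Hr b Bb) as (a & Ha & Aa). exists a. split; [assumption|].
    apply Hn. exists a. split; [|reflexivity].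
    exists (spair (scons m q) b). rewrite !sfst_spair, !ssnd_spair.
    split; [|exact Ha]. exists (scons m q), b. auto. }
  destruct HB as [b0 Hb0].
  assert (Q' : forall s, mcomp (mv_r (mv_pt (mv_const B))) (phi k) p s ->
               mv_r (mv_pt (mv_const B)) ones s).
  { intros s (_ & y & Hy & Hs). now rewrite (Ek y Hy) in Hs. }
  split.
  - destruct (Q (const_name b0)) as (a & Aa & Ha); [now apply mv_r_pt_const|].
    exists (const_name a). split.
    + intros s Hs. destruct (Q s (Q' s Hs)) as (a' & _ & Ha').
      exists (const_name a'). exact Ha'.
    + exists (const_name b0). split; [|exact Ha]. split.
      * intros y Hy. rewrite (Ek y Hy). exists (const_name b0).
        now apply mv_r_pt_const.
      * exists ones. split; [now apply Hk|now apply mv_r_pt_const].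
  - intros s (_ & t & Ht & Hs). destruct (Q t (Q' t Ht)) as (a & Aa & Ha).
    rewrite (graph_functional _ _ _ _ Hs Ha). now apply mv_r_pt_const.
Qed.

(** The query program [k] is never run: [const_name b] answers every query, so it can be handed to
    the answer program [m] directly. The outcome solves the instance [ones], where entry [0] decodes
    to an element of [A]. *)
Lemma med_imp_of_mv_mimp (phi : nat -> pfun) (Hphi : goedel_numbering phi)
  (A B : baire -> Prop) :
  (exists a, A a) ->
  exists n, forall t,
    mv_mimp phi (mv_pt (mv_const B)) (mv_pt (mv_const A)) ones t ->
    med_imp phi B A (scons n t).
Proof.
  intros HA.
  destruct (phi_index phi Hphi (fun P q => exists w,
    phi (sfst P 0) (spair (stail (stail (sfst P))) (const_name (ssnd P))) w /\
    dec (sproj 0 w) q)) as [n Hn].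
  { apply pcomp_comp.
    - apply (pcomp_pre (fun P => scons (sfst P 0)
        (spair (stail (stail (sfst P))) (const_name (ssnd P)))) _)
        with (2 := pcomp_phi phi Hphi).
      apply (bcomp_scons (fun w => sfst w)); [apply bcomp_sfst, bcomp_id|].
      apply bcomp_spair.
      + apply bcomp_stail, bcomp_stail, bcomp_sfst, bcomp_id.
      + apply bcomp_const_name, bcomp_ssnd, bcomp_id.
    - apply pcomp_pre; [apply bcomp_sproj, bcomp_id|apply pcomp_dec]. }
  exists n. intros t (m & k & q & Et & [s0 Hh] & Hsub).
  exists n, t. split; [reflexivity|]. intros b Hb.
  (* From [k] only the existence of a query [y] is kept. *)
  destruct Hh as (D & r & (D' & y & Hy & _) & _).
  assert (M : mcomp (mv_r (mv_pt (mv_const B))) (phi k) ones (const_name b)).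
  { split; [assumption|]. exists y. split; [assumption|now apply mv_r_pt_const]. }
  destruct (D _ M) as [s Hs].
  assert (Fs : mv_r (mv_pt (mv_const A)) ones s).
  { apply Hsub. split; [assumption|]. exists (const_name b). auto. }
  destruct (mv_r_pt_ones A HA s Fs) as (a & Ha & Aa).
  exists a. split; [|assumption]. apply Hn. exists s.
  rewrite sfst_spair, ssnd_spair, Et. auto.
Qed.

Lemma wdeg_const_imp (phi : nat -> pfun) (Hphi : goedel_numbering phi) A B :
  wdeg (p_const (med_imp phi B A)) = wdeg (ptw_imp phi (p_const B) (p_const A)).
Proof.
  unfold ptw_imp. destruct (classic (exists b, B b)) as [HB|HB].
  (* With [B] empty every stream lies in the Medvedev implication, and on the other side the premise
     is [Top]. *)
  2:{ rewrite (p_const_empty B HB). simpl. rewrite wdeg_zero.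
      apply wdeg_const_eq. f_equal. extensionality r.
      apply propositional_extensionality. split; [easy|intros _].
      exists (r 0), (stail r). split.
      - now extensionality i; destruct i.
      - intros p Hp. exfalso. eauto. }
  rewrite (p_const_nonempty B HB). destruct (classic (exists a, A a)) as [HA|HA].
  2:{ rewrite (p_const_empty A HA), p_const_empty; [reflexivity|].
      intros (r & n & q & _ & Hr). destruct HB as [b Hb].
      destruct (Hr b Hb) as (s & _ & Hs). eauto. }
  rewrite (p_const_nonempty A HA).
  change (p_mimp phi (p_pt (Prob (mv_const B))) (p_pt (Prob (mv_const A)))) with
    (p_mimp phi (Prob (mv_pt (mv_const B))) (Prob (mv_pt (mv_const A)))).
  unfold p_mimp. destruct (excluded_middle_informative _) as [_|N].
  2:{ exfalso. apply N. left. exists (fun _ => Some (fun _ : nat => 0)).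
      apply mv_pt_total. }
  destruct (mv_mimp_of_med_imp phi Hphi A B HB) as (n & k & Hnk).
  destruct (med_imp_nonempty phi Hphi A B HA) as [r0 Hr0].
  destruct (med_imp_of_mv_mimp phi Hphi A B HA) as [n' Hn'].
  apply wdeg_eq. split.
  - apply w_le_ptw_le.
    apply const_w_le with (k0 := ones) (x0 := ones) (E := fun t q => q = scons n' t);
      [eauto| |exact (bcomp_cst 1)|reflexivity| |].
    + apply pcomp_total, (bcomp_scons (fun _ _ => n')); [bc|apply bcomp_id].
    + exists (scons n (scons k r0)). auto.
    + intros q y Hq Hy. simpl in Hq. subst q. eauto.
  - apply ptw_le_const with (E := fun r q => q = scons n (scons k (ssnd r))).
    + apply pcomp_total, (bcomp_scons (fun _ _ => n)); [bc|].
      apply (bcomp_scons (fun _ _ => k)); [bc|apply bcomp_ssnd, bcomp_id].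
    + intros r p x Hr Hp _. rewrite ssnd_spair.
      exists (scons n (scons k r)), (scons n (scons k r)).
      split; [reflexivity|]. split; [reflexivity|]. now apply Hnk.
Qed.

Theorem theorem8p8 (phi : nat -> pfun) (Hphi : goedel_numbering phi) :
  exists c : mdegree -> wdegree,
    (forall A : baire -> Prop, c (mdeg A) = wdeg (p_const A)) /\
    (forall a b : mdegree, c a = c b -> a = b) /\
    (forall A B : baire -> Prop,
       med_le A B <-> ptw_le (p_const A) (p_const B)) /\
    (forall A B : baire -> Prop,
       c (mdeg (med_otimes A B)) = wdeg (ptw_inf (p_const A) (p_const B))) /\
    (forall A B : baire -> Prop,
       c (mdeg (med_oplus A B)) = wdeg (p_sup (p_const A) (p_const B))) /\
    (forall A B : baire -> Prop,
       c (mdeg (med_imp phi B A)) =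
         wdeg (ptw_imp phi (p_const B) (p_const A))) /\
    c (mdeg (fun _ => True)) = wdeg p_id /\
    c (mdeg (fun _ => False)) = wdeg Top.
Proof.
  (* A representative is chosen for each degree; by [wdeg_const_eq] the choice does not affect the
     value. *)
  pose (r := fun d => constructive_indefinite_description _ (deg_surjective med_le d)).
  pose (c := fun d : mdegree => wdeg (p_const (proj1_sig (r d)))).
  assert (Hc : forall A, c (mdeg A) = wdeg (p_const A)).
  { intros A. apply wdeg_const_eq. symmetry. exact (proj2_sig (r (mdeg A))). }
  exists c. split; [exact Hc|]. split.
  { intros a b E. rewrite (proj2_sig (r a)), (proj2_sig (r b)).
    apply mdeg_eq. rewrite !med_le_ptw_le. now apply wdeg_eq. }
  split; [exact med_le_ptw_le|].
  split; [intros A B; rewrite Hc; apply wdeg_const_otimes|].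
  split; [intros A B; rewrite Hc; apply wdeg_const_oplus|].
  split; [intros A B; rewrite Hc; now apply wdeg_const_imp|].
  split; [rewrite Hc; apply wdeg_const_true|].
  rewrite Hc, p_const_empty; [reflexivity|]. now intros [q []].
Qed.
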